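(* For every integer $n\geq 1$, the inner arc complex $\mathcal{A}_{\mathcal{C}}(\mathcal{M}_n)$ of the non-orientable crown $\mathcal{M}_n$ with $n$ vertices is strongly collapsible.
   Context: Surface. For $n\ge 1$, the non-orientable crown $\mathcal{M}_n$ is the Möbius strip with $n$ distinct marked points (vertices) on its boundary circle, labeled $1,\dots,n$ in cyclic order. The portion of the boundary between two consecutive vertices is an edge (for $n=1$, the single edge is the whole boundary circle). Arcs. A simple arc is an arc in the surface whose two endpoints are vertices (possibly the same vertex), which is embedded except that its endpoints may coincide, and whose interior avoids the boundary. Homotopies of arcs are relative to endpoints. An arc is trivial if it is homotopic, relative to its endpoints, to a vertex or to an edge. Only simple non-trivial arcs are considered. Two homotopy classes are disjoint if they have representatives that are disjoint (except possibly at endpoints). An arc of $\mathcal{M}_n$ is a boundary arc (b-arc) if it decomposes the strip into one orientable and one non-orientable subsurface; any other arc is a core arc (c-arc). A c-arc always intersects the one-sided core curve of the Möbius strip. Inner arc complex. $\mathcal{A}_{\mathcal{C}}(\mathcal{M}_n)$ is the simplicial complex whose 0-simplices are the homotopy classes of all simple non-trivial c-arcs of $\mathcal{M}_n$, and whose $k$-simplices ($k\ge1$) are the sets of $k+1$ pairwise disjoint and distinct such homotopy classes. Strong collapse. A 0-simplex $v$ of a simplicial complex $X$ is vertex-dominated if there is another 0-simplex $v'$ such that the link of $v$ in $X$ is a join $v'*L$ for some subcomplex $L$ of $X$ (equivalently, every maximal simplex containing $v$ contains $v'$; $L$ may be the empty complex). In that case $X$ strongly collapses onto $X\smallsetminus\{v\}:=\{\eta\in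 X\mid v\notin\eta\}$. A finite complex is strongly collapsible if some finite sequence of strong collapses (possibly of length zero) reduces it to a single 0-simplex. *)

(* Defs.v *)
(* MathComp / MathComp-Analysis *)
From HB Require Import structures.
From mathcomp Require Import all_boot all_order all_algebra generic_quotient.
From mathcomp Require Import all_classical all_reals all_analysis.
Import Order.TTheory GRing.Theory Num.Theory.
Import numFieldNormedType.Exports.

Set Implicit Arguments.
Unset Strict Implicit.
Unset Printing Implicit Defensive.

Local Open Scope classical_set_scope.
Local Open Scope ring_scope.
Local Open Scope quotient_scope.

Section Complexes.
Context {V : Type}.
Implicit Types (X L : set (set V)) (v : V).

(* A complex is the collection of its nonempty simplices; the 0-simplices are
   the singletons it contains. *)
Definition simplicial_complex X : Prop :=
  forall s, X s ->
    [/\ finite_set s, s !=set0 & forall t, t `<=` s -> t !=set0 -> X t].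

Definition link X v : set (set V) :=
  [set s | X s /\ ~ s v /\ X (v |` s)].

(* The join of the 0-simplex [v] with [L]; [L] may be [set0]. *)
Definition vertex_join v L : set (set V) :=
  [set s | s = [set v] \/ L s \/ exists2 t, L t & s = v |` t].

Definition vertex_dominated X v v' : Prop :=
  [/\ X [set v], X [set v'], v' <> v &
      exists L, [/\ simplicial_complex L, L `<=` X, ~ L [set v'] &
                    link X v = vertex_join v' L]].

Definition vertex_deletion X v : set (set V) := [set s | X s /\ ~ s v].

Inductive collapses_to_vertex X : Prop :=
| collapse_nil v of X = [set [set v]]
| collapse_cons v v' of vertex_dominated X v v'
    & collapses_to_vertex (vertex_deletion X v).

Definition strongly_collapsible X : Prop :=
  [/\ simplicial_complex X, finite_set X & collapses_to_vertex X].

End Complexes.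

Section Moebius.
Variable R : realType.

Definition strip : set (R * R) := [set p | -1 <= p.2 <= 1].

(* The infinite cyclic group generated by the glide reflection
   (x, y) |-> (x + 1, - y) acts on the strip; the Moebius strip is the
   quotient. *)
Definition deck_rel (p q : strip) : bool :=
  `[< exists k : int, (val q).1 = (val p).1 + k%:~R /\
                      (val q).2 = (-1) ^ k * (val p).2 >].

Lemma deck_rel_equiv : equiv_class_of deck_rel.
Proof.
have exprD (k l : int) : (-1) ^ k * (-1) ^ l = (-1) ^ (k + l) :> R.
  by rewrite expfzDr// oppr_eq0 oner_eq0.
have symP p q : deck_rel p q -> deck_rel q p.
  move=> /asboolP[k [E1 E2]]; apply/asboolP; exists (- k).
  by rewrite E1 E2 rmorphN /= addrK mulrA exprD addNr expr0z mul1r.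
split.
- by move=> p; apply/asboolP; exists 0; rewrite addr0 expr0z mul1r.
- by move=> p q; apply/idP/idP; apply: symP.
- move=> q p r /asboolP[k [E1 E2]] /asboolP[l [F1 F2]].
  apply/asboolP; exists (k + l).
  by rewrite F1 F2 E1 E2 rmorphD /= addrA mulrA exprD [(l + k)%R]addrC.
Qed.

Canonical deck_equiv := EquivRelPack deck_rel_equiv.

Definition moebius := quotient_topology {eq_quot deck_equiv}.
HB.instance Definition _ := Topological.on moebius.
HB.instance Definition _ := Quotient.on moebius.

Definition to_moebius (p : strip) : moebius := \pi_moebius p.

Lemma bottom_pt_subproof (x : R) : strip (x, -1).
Proof. by rewrite /strip /= lexx /= (le_trans (lerN10 R)) ?ler01. Qed.

Definition bottom_pt (x : R) : strip :=
  exist _ (x, -1) (mem_set (bottom_pt_subproof x)).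

(* Both sides y = -1 and y = 1 of the strip project onto the boundary circle,
   so this is a parametrization of that circle, of period 2. *)
Definition bd (x : R) : moebius := to_moebius (bottom_pt x).

Definition boundary : set moebius := range bd.

(* [U] is meant to be open. An orientation of [U] is an orientation of its
   preimage in the strip that is invariant under the glide reflection;
   compared with the standard orientation of the plane it is a locally
   constant sign, and since the glide reflection reverses the standard
   orientation, invariance means that it changes this sign. *)
Definition orientable (U : set moebius) : Prop :=
  exists e : strip -> bool,
    {within to_moebius @^-1` U, continuous e} /\
    forall p q : strip, U (to_moebius p) ->
      (val q).1 = (val p).1 + 1 -> (val q).2 = - (val p).2 -> e q = ~~ e p.

(* Curves are functions on the real line of which only the restriction to
   [0, 1] is relevant. *)
Definition curve : Type := R -> moebius.
Implicit Types g h : curve.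

Definition reverse g : curve := fun t => g (1 - t).

Definition homotopic_rel_ends g h : Prop :=
  exists H : R * R -> moebius,
    [/\ {within `[0, 1] `*` `[0, 1], continuous H},
        forall t, 0 <= t <= 1 -> H (0, t) = g t /\ H (1, t) = h t &
        forall s, 0 <= s <= 1 -> H (s, 0) = g 0 /\ H (s, 1) = g 1].

(* Arcs are unoriented. *)
Definition homotopic g h : Prop :=
  homotopic_rel_ends g h \/ homotopic_rel_ends g (reverse h).

Section Crown.
Variable n : nat.

Definition vertex (k : nat) : moebius := bd (2 * k%:R / n%:R).

Definition vertices : set moebius := [set vertex k | k in [set k | (k < n)%N]].

(* From [vertex k] to [vertex k.+1], where [vertex n] is [vertex 0]. *)
Definition edge (k : nat) : curve := fun t => bd (2 * (k%:R + t) / n%:R).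

Definition simple_arc g : Prop :=
  [/\ {within `[0, 1], continuous g},
      vertices (g 0) /\ vertices (g 1),
      forall t, 0 < t < 1 -> ~ boundary (g t) &
      forall s t, 0 <= s -> s < t -> t <= 1 -> g s = g t -> s = 0 /\ t = 1].

Definition trivial_arc g : Prop :=
  exists2 k, (k < n)%N & homotopic g (cst (vertex k)) \/ homotopic g (edge k).

Definition decomposes g : Prop :=
  exists U W : set moebius,
    [/\ ~` (g @` `[0, 1]) = U `|` W, U `&` W = set0,
        [/\ open U, connected U & U !=set0],
        [/\ open W, connected W & W !=set0] &
        orientable U /\ ~ orientable W].

Definition arc_class g : set curve := [set h | simple_arc h /\ homotopic g h].

(* Arcs are considered up to homotopy: being a b-arc or a c-arc is a property
   of homotopy classes, and a class consists of b-arcs as soon as one of the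
   simple arcs in it decomposes the strip. *)
Definition b_class (A : set curve) : Prop := exists2 g, A g & decomposes g.

Definition c_class (A : set curve) : Prop :=
  (exists g, [/\ simple_arc g, ~ trivial_arc g & A = arc_class g]) /\
  ~ b_class A.

Definition disjoint_classes (A B : set curve) : Prop :=
  exists g h, [/\ A g, B h &
    forall s t, 0 <= s <= 1 -> 0 <= t <= 1 -> g s = h t ->
      (s = 0 \/ s = 1) /\ (t = 0 \/ t = 1)].

Definition inner_arc_complex : set (set (set curve)) :=
  [set S | [/\ finite_set S, S !=set0, S `<=` c_class &
      forall A B, S A -> S B -> A <> B -> disjoint_classes A B]].

End Crown.
End Moebius.

Arguments strip : clear implicits.
Arguments boundary : clear implicits.
Arguments vertices : clear implicits.
Arguments inner_arc_complex : clear implicits.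

(* Main.v *)
From HB Require Import structures.
Require Import Defs.
From mathcomp Require Import finmap.
From mathcomp Require Import all_boot all_order all_algebra generic_quotient.
From mathcomp Require Import all_classical all_reals all_analysis.
From mathcomp Require Import ring lra zify.
Import Order.TTheory GRing.Theory Num.Theory.
Import numFieldNormedType.Exports.

Set Implicit Arguments.
Unset Strict Implicit.
Unset Printing Implicit Defensive.

Local Open Scope classical_set_scope.
Local Open Scope ring_scope.
Local Open Scope quotient_scope.

(** The strip is the universal cover of the Moebius strip, so everything is
    read off from lifted end points.  Write [bot a] and [top b] for the lifts of
    the vertices on the two sides of the strip, indexed by integers.  Since
    the strip is convex, the homotopy class of an arc is given by the end points
    of a lift up to the deck group ([homotopicP]), and an arc is of one of two
    kinds: from [bot a] to [bot b], or from [bot a] to [top b].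

    The topology enters through one planar fact: two paths of a strip whose end
    points are linked on its boundary meet.  If they did not, the angle of the
    difference of a point of the first and a point of the second would be a
    continuous function on the square of parameters, while the half planes in
    which the difference stays along the four sides of the square force the
    angle to turn once around ([swapped_crosscuts_meet], [linked_arcs_meet],
    [crosscut_separates]).  It has the following consequences.

    - A simple arc from [bot a] to [top b] does not cross its translates, which
      means a <= b <= a + n ([simple_top]).  It does not decompose the surface
      into an orientable and a non-orientable part: a loop that avoids it and
      reverses the orientation would lift to a path from far left to far right
      in the strip that avoids a path from bottom to top
      ([crosscut_orientable]).
    - A simple arc from [bot a] to [bot b] satisfies |b - a| <= n
      ([simple_bot]).  It is trivial if |b - a| <= 1; otherwise it is homotopic
      to an explicit graph [bow] that cuts off a disc, hence is a b-arc.
    - Two classes of c-arcs are disjoint exactly when no two of their lifts are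
      linked ([disjoint_noncrossing], [noncrossing_disjoint]), straight chords
      being disjoint representatives.

    So the inner arc complex is the clique complex of a graph on pairs (a, b) of
    integers with a <= b <= a + n, taken up to (a, b) ~ (b, a + n); two pairs
    are adjacent when all their representatives are comparable in the product
    order.  Call min(b - a, n - (b - a)) the level of a pair.  As
    long as 2 d + 1 < n, a pair (a, b) of least level d = b - a among the
    remaining ones is dominated by (a, b + 1): a pair (c, e) that is comparable
    with (a, b) but not with (a, b + 1) would have b = e and a < c, hence
    e - c < d.  Removing the pairs level by level leaves in the end a set on
    which the values of b - a differ by at most one, and such a set is a clique,
    in which every vertex dominates every other one ([dominating]). *)

(** * Continuous angles on the unit square *)
Section Angle.
Variable R : realType.
Implicit Types (z w : R * R) (f : R * R -> R * R).

Definition square : set (R * R) := `[0, 1] `*` `[0, 1].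

Definition directed z (a : R) : Prop :=
  exists2 r, 0 < r & z = (r * cos a, r * sin a).

(** The angle from [z] to [w], in the range where the scalar product of [z]
    and [w] is positive. *)
Definition turn z w : R :=
  atan ((w.2 * z.1 - w.1 * z.2) / (w.1 * z.1 + w.2 * z.2)).

(** This is the product formula for complex numbers: [w] times the conjugate
    of [z] lies in the right half plane, where the arctangent gives its
    argument. *)
Lemma directed_turn z w a : 0 < w.1 * z.1 + w.2 * z.2 ->
  directed z a -> directed w (a + turn z w).
Proof.
case: z w => u v [u' v']; rewrite /turn /= => A0 [r r0 [uE vE]].
set A := u' * u + v' * v in A0 *; set B := v' * u - u' * v.
have h : cos (atan (B / A)) != 0.
  by rewrite cos_atan invr_eq0 gt_eqF// sqrtr_gt0 ltr_pwDl// sqr_ge0.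
have sE : sin (atan (B / A)) = B / A * cos (atan (B / A)).
  by have := atanK (B / A); rewrite /tan => {2}<-; rewrite divfK.
have c0 : 0 < cos (atan (B / A)).
  by rewrite cos_atan invr_gt0 sqrtr_gt0 ltr_pwDl// sqr_ge0.
have ccss : cos a ^+ 2 + sin a ^+ 2 = 1 by rewrite cos2Dsin2.
exists (A / (r * cos (atan (B / A)))).
  by rewrite divr_gt0// mulr_gt0.
rewrite cosD sinD sE; set c := cos (atan _) in h c0 *.
have An0 : A != 0 by rewrite gt_eqF.
have rn0 : r != 0 by rewrite gt_eqF.
have u'E : u' * r = A * cos a - B * sin a.
  rewrite /A /B uE vE.
  have -> : u' * r = u' * r * (cos a ^+ 2 + sin a ^+ 2) by rewrite ccss mulr1.
  ring.
have v'E : v' * r = A * sin a + B * cos a.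
  rewrite /A /B uE vE.
  have -> : v' * r = v' * r * (cos a ^+ 2 + sin a ^+ 2) by rewrite ccss mulr1.
  ring.
congr pair; apply: (mulIf rn0).
  by rewrite u'E; field; rewrite h An0 rn0.
by rewrite v'E; field; rewrite h An0 rn0.
Qed.

Lemma compact_square : compact square.
Proof. by apply: compact_setX; exact: segment_compact. Qed.

Lemma square_uniform f (e : R) : continuous f -> 0 < e ->
  exists2 d : R, 0 < d &
    forall p q, square p -> `|p - q| < d -> `|f p - f q| < e.
Proof.
move=> cf e0.
have /compact_near_coveringP := compact_square.
move=> /(_ R (0 : R)^'+ (fun (d : R) p => forall q, `|p - q| < d -> `|f p - f q| < e) _).
case=> [p _|d /= d0 H].
  have /cvgrPdist_lt/(_ (e / 2)) := cf p.
  rewrite divr_gt0// => /(_ isT) /nbhs_ballP[d /= d0 H].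
  exists (ball p (d / 2), [set x | 0 < x < d / 2]) => /=.
    split; first by apply: nbhsx_ballx; rewrite divr_gt0.
    exists (d / 2); rewrite /= ?divr_gt0// => x /=.
    by rewrite sub0r normrN => xd x0; rewrite x0 (le_lt_trans (ler_norm _)).
  move=> [p' x] /= [pp' /andP[x0 xd]] q p'q.
  rewrite -ball_normE /= in pp'.
  have h1 : `|f p - f p'| < e / 2.
    by apply: H; rewrite -ball_normE /=; apply: lt_trans pp' _; rewrite ltr_pdivrMr// mulr_natr mulr2n ltrDl.
  have h2 : `|f p - f q| < e / 2.
    apply: H; rewrite -ball_normE /=.
    have -> : p - q = (p - p') + (p' - q) by rewrite addrA subrK.
    rewrite (le_lt_trans (ler_normD _ _))// (splitr d) ltrD//.
    exact: lt_trans xd.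
  have -> : f p' - f q = (f p - f q) - (f p - f p') by rewrite opprB [RHS]addrC addrA subrK.
  by rewrite (le_lt_trans (ler_normB _ _))// (splitr e) ltrD.
exists (d / 2); first by rewrite divr_gt0.
move=> p q sp; apply: H => //=; last by rewrite divr_gt0.
rewrite sub0r normrN gtr0_norm ?divr_gt0//.
by rewrite ltr_pdivrMr// mulr_natr mulr2n ltrDl.
Qed.
End Angle.
Arguments square {R}.

Section Arg.
Variable R : realType.
Implicit Types (z w : R * R) (f : R * R -> R * R).

(** Composing with the retraction onto [0, 1] makes functions that are only
    relevant on the interval continuous everywhere. *)
Definition clamp (t : R) : R := Num.max 0 (Num.min 1 t).

Lemma clampP t : 0 <= clamp t <= 1.
Proof. by rewrite /clamp le_max lexx ge_max ler01 ge_min lexx. Qed.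

Lemma clampE t : 0 <= t <= 1 -> clamp t = t.
Proof. by case/andP=> t0 t1; rewrite /clamp (min_idPr t1) (max_idPr t0). Qed.

Lemma clamp_le0 t : t <= 0 -> clamp t = 0.
Proof. by move=> t0; rewrite /clamp (min_idPr (le_trans t0 ler01)) (max_idPl t0). Qed.

Lemma clamp_ge1 t : 1 <= t -> clamp t = 1.
Proof. by move=> t1; rewrite /clamp (min_idPl t1) (max_idPr ler01). Qed.

Lemma continuous_clamp : continuous clamp.
Proof.
move=> t; apply: (@continuous_max R R (cst 0) (fun t => Num.min 1 t)).
  exact: cst_continuous.
by apply: (@continuous_min R R (cst 1) id); [exact: cst_continuous|exact: cvg_id].
Qed.

Definition clamp2 (p : R * R) : R * R := (clamp p.1, clamp p.2).

Lemma continuous_pair (T : topologicalType) (U V : topologicalType)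
  (u : T -> U) (v : T -> V) : continuous u -> continuous v ->
  continuous (fun t => (u t, v t)).
Proof. by move=> cu cv t; apply: cvg_pair; [exact: cu|exact: cv]. Qed.

Lemma continuous_fst (T U V : topologicalType) (f : T -> U * V) :
  continuous f -> continuous (fun t => (f t).1).
Proof. by move=> cf t; apply: (cvg_comp _ _ (cf t)); exact: cvg_fst. Qed.

Lemma continuous_snd (T U V : topologicalType) (f : T -> U * V) :
  continuous f -> continuous (fun t => (f t).2).
Proof. by move=> cf t; apply: (cvg_comp _ _ (cf t)); exact: cvg_snd. Qed.

Lemma continuous_clamp2 : continuous clamp2.
Proof.
by apply: continuous_pair => p; apply: continuous_comp => //;
   [exact: cvg_fst|exact: continuous_clamp|exact: cvg_snd|exact: continuous_clamp].
Qed.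

Lemma square_clamp2 p : square (clamp2 p).
Proof. by split; rewrite /= in_itv/= clampP. Qed.

Lemma clamp2E p : square p -> clamp2 p = p.
Proof. by case: p => s t [/= s1 t1]; rewrite /clamp2 /= !clampE. Qed.

(** Two vectors at a distance less than half of their sup norm form an acute
    angle. *)
Lemma near_pos_dot (m u v u' v' : R) : 0 < m -> m <= Num.max `|u| `|v| ->
  `|u - u'| < m / 2 -> `|v - v'| < m / 2 -> 0 < u' * u + v' * v.
Proof.
move=> m0 mM hu hv.
have h x x' : `|x - x'| < m / 2 -> `|x| ^+ 2 - m / 2 * `|x| <= x' * x.
  move=> hx; rewrite real_normK ?num_real// lerBlDl -lerBlDr.
  have -> : x ^+ 2 - x' * x = (x - x') * x by ring.
  rewrite (le_trans (ler_norm _))// normrM ler_wpM2r// ltW//.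
have := h _ _ hu; have := h _ _ hv; move: mM; rewrite le_max.
move: `|u| `|v| (u' * u) (v' * v) => a b x y.
have m2 : 0 < m ^+ 2 by rewrite exprn_gt0.
have k c : m <= c -> m ^+ 2 / 2 <= c ^+ 2 - m / 2 * c.
  move=> mc; rewrite -subr_ge0.
  have -> : c ^+ 2 - m / 2 * c - m ^+ 2 / 2 = (c - m) * (c + m / 2) by field.
  by rewrite mulr_ge0//; lra.
have l c : - (m ^+ 2 / 4) <= c ^+ 2 - m / 2 * c.
  rewrite -subr_ge0.
  have -> : c ^+ 2 - m / 2 * c - - (m ^+ 2 / 4) =
    (c - m / 4) ^+ 2 + 3 / 16 * m ^+ 2 by field.
  by rewrite addr_ge0 ?sqr_ge0//; lra.
by case/orP=> /k kc; have := l a; have := l b; lra.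
Qed.

(** A continuous argument exists because the square is star-shaped around its
    corner (0, 0).  By compactness there is a number N of steps such that [f] turns by
    less than a right angle between i / N * p and (i + 1) / N * p, for all p at
    once; the argument of [f p] is the sum of these N small turns. *)
Lemma angle_lift f o : continuous f -> (forall p, square p -> f p != 0) ->
  directed (f (0, 0)) o ->
  exists a : R * R -> R, [/\ continuous a, a (0, 0) = o &
    forall p, square p -> directed (f p) (a p)].
Proof.
move=> cf fn0 dfo.
have [m m0 mf] : exists2 m : R, 0 < m & forall p, square p -> m <= `|f p|.
  have := @compact_EVT_min _ R (fun p => `|f p|) square.
  case.
  - by exists (0, 0); split; rewrite /= in_itv/= lexx ler01.
  - exact: compact_square.
  - apply: continuous_subspaceT => p.
    by apply: (@continuous_comp _ _ _ f (fun z => `|z|)); [exact: cf|exact: norm_continuous].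
  move=> c; rewrite inE => sc fc; exists `|f c|.
    by rewrite normr_gt0 fn0.
  by move=> p sp; apply: fc; rewrite inE.
have m20 : 0 < m / 2 by rewrite divr_gt0.
have [d d0 df] := square_uniform cf m20.
(* The number of steps; any N with 1 / N < d would do. *)
pose N := (Num.truncn (2 / d)).+1.
have N0 : 0 < N%:R :> R by rewrite ltr0n.
have Nd : N%:R^-1 < d.
  rewrite invf_plt ?posrE// (le_lt_trans _ (truncnS_gt _))//.
  by rewrite ler_peMl ?invr_ge0 ?(ltW d0)// ler1n.
pose F (i : nat) p := f ((i%:R / N%:R) *: clamp2 p).
have cF i : continuous (F i).
  move=> p.
  apply: (continuous_comp (f := fun p => (i%:R / N%:R) *: clamp2 p)); last exact: cf.
  by apply: continuousZl_tmp; exact: continuous_clamp2.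
have sq_scale (k : R) p : 0 <= k <= 1 -> square p -> square (k *: p).
  move=> /andP[k0 k1] [/= +]; rewrite !in_itv /= => /andP[a0 a1] /andP[b0 b1].
  by split; rewrite /= in_itv /= mulr_ge0//= mulr_ile1.
have A0 (i : nat) p : (i < N)%N ->
    0 < (F i.+1 p).1 * (F i p).1 + (F i.+1 p).2 * (F i p).2.
  move=> iN.
  have sk (j : nat) : (j <= N)%N -> 0 <= (j%:R / N%:R : R) <= 1.
    by move=> jN; rewrite divr_ge0//= ler_pdivrMr// mul1r ler_nat.
  have h1 := mf _ (sq_scale _ _ (sk _ (ltnW iN)) (square_clamp2 p)).
  have h2 : `|F i p - F i.+1 p| < m / 2.
    apply: df.
      by apply: sq_scale; [apply: sk; exact: ltnW|exact: square_clamp2].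
    rewrite -scalerBl normrZ -mulrBl -opprB -[i.+1%:R]natr1 addrAC subrr add0r.
    rewrite mulN1r normrN ger0_norm ?invr_ge0// (le_lt_trans _ Nd)//.
    rewrite ler_piMr ?invr_ge0// prod_normE ge_max /=.
    have /andP[a0 a1] := clampP p.1; have /andP[b0 b1] := clampP p.2.
    by rewrite !ger0_norm// a1 b1.
  move: h1 h2; rewrite !prod_normE /= gt_max => h1 /andP[]; exact: near_pos_dot.
exists (fun p => o + \sum_(i < N) turn (F i p) (F i.+1 p)); split.
- suff : forall k, (k <= N)%N ->
      continuous (fun p => o + \sum_(i < k) turn (F i p) (F i.+1 p)) by exact.
  elim=> [_|k IH kN].
    by under eq_fun do rewrite big_ord0; exact: cst_continuous.
  under eq_fun do rewrite big_ord_recr /= addrA.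
  have c1 j := continuous_fst (cF j); have c2 j := continuous_snd (cF j).
  move=> p; apply: cvgD; first exact: (IH (ltnW kN)).
  rewrite /turn; apply: continuous_cvg; first exact: continuous_atan.
  apply: cvgM; first by apply: cvgB; apply: cvgM; (exact: c1) || exact: c2.
  apply: cvgV; first by rewrite gt_eqF// A0.
  by apply: cvgD; apply: cvgM; (exact: c1) || exact: c2.
- have c00 : clamp2 (0, 0) = 0 by rewrite clamp2E//; split; rewrite /= in_itv/= lexx ler01.
  rewrite big1 ?addr0// => i _.
  rewrite /F c00 !scaler0 /turn.
  by rewrite [_.2 * _.1]mulrC subrr mul0r atan0.
- move=> p sp.
have : forall k, (k <= N)%N -> directed (F k p) (o + \sum_(i < k) turn (F i p) (F i.+1 p)).
  elim=> [_|k IH kN].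
    by rewrite big_ord0 addr0 /F mul0r scale0r.
  rewrite big_ord_recr /= addrA; apply: directed_turn; first exact: A0.
  exact: IH (ltnW kN).
move=> /(_ N (leqnn _)).
by rewrite {1}/F divff ?gt_eqF// scale1r clamp2E.
Qed.
End Arg.

(** * Paths in the strip that have to meet *)
Section Crossing.
Variable R : realType.
Implicit Types (z w : R * R) (f : R * R -> R * R) (g d : R -> R * R).

Lemma cos_lt0 (x : R) : pi / 2 < x <= pi -> cos x < 0.
Proof.
move=> /andP[x1 x2]; rewrite -cos_pihalf ltr_cos//; have := pi_gt0 R => p0;
  rewrite in_itv /=; lra.
Qed.

(** While a vector stays in the closed half plane centred at the direction
    [b], its continuous argument cannot leave the interval of length pi around
    [b]: to get out it would take a value whose cosine relative to [b] is
    negative. *)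
Lemma halfplane_stay (h : R -> R) (z : R -> R * R) (b : R) :
  continuous h -> (forall t, 0 <= t <= 1 -> directed (z t) (h t)) ->
  (forall t, 0 <= t <= 1 -> 0 <= (z t).1 * cos b + (z t).2 * sin b) ->
  `|h 0 - b| <= pi / 2 -> `|h 1 - b| <= pi / 2.
Proof.
move=> ch dz zb h0; rewrite leNgt; apply/negP => h1.
pose k (t : R) := `|h t - b|.
have ck : continuous k.
  move=> t; apply: continuous_cvg; first exact: norm_continuous.
  by apply: cvgB; [exact: ch|exact: cvg_cst].
have p0 := pi_gt0 R.
(* Capping at pi keeps the value in the range where the cosine is negative. *)
have [||c c01 kc] := @IVT R k 0 1 (Num.min (k 1) pi) ler01.
- exact: continuous_subspaceT.
- rewrite ge_min le_max le_min.
  rewrite -/(k 0) -/(k 1) in h0 h1 *.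
  by apply/andP; split; apply/orP; [left|right]; rewrite ?ge_min; lra.
have c01' : 0 <= c <= 1 by rewrite in_itv in c01.
have /cos_lt0 : pi / 2 < k c <= pi.
  by rewrite kc lt_min ge_min lexx orbT h1/= andbT; lra.
rewrite /k cos_norm cosB; apply/negP; rewrite -leNgt.
have [r r0 zE] := dz _ c01'; have := zb _ c01'; rewrite zE /=.
by rewrite -!mulrA -mulrDr pmulr_rge0.
Qed.

Lemma directed_cos z a : directed z a -> (0 <= z.1) = (0 <= cos a).
Proof. by case=> r r0 ->; rewrite /= pmulr_rge0. Qed.

Lemma directed_sin z a : directed z a -> (0 <= z.2) = (0 <= sin a).
Proof. by case=> r r0 ->; rewrite /= pmulr_rge0. Qed.

Lemma directed_sin_gt z a : directed z a -> (0 < z.2) = (0 < sin a).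
Proof. by case=> r r0 ->; rewrite /= pmulr_rgt0. Qed.

Lemma unit_itv0 : 0 <= (0 : R) <= 1. Proof. by rewrite lexx ler01. Qed.
Lemma unit_itv1 : 0 <= (1 : R) <= 1. Proof. by rewrite lexx ler01. Qed.

Lemma squareE (s t : R) : 0 <= s <= 1 -> 0 <= t <= 1 -> square (s, t).
Proof. by move=> s1 t1; split; rewrite /= in_itv. Qed.

Section Sides.
Variables (f : R * R -> R * R) (a : R * R -> R).
Hypotheses (ca : continuous a)
  (da : forall s t, 0 <= s <= 1 -> 0 <= t <= 1 -> directed (f (s, t)) (a (s, t))).

Lemma horizontal_side t b : 0 <= t <= 1 ->
  (forall s, 0 <= s <= 1 -> 0 <= (f (s, t)).1 * cos b + (f (s, t)).2 * sin b) ->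
  `|a (0, t) - b| <= pi / 2 -> `|a (1, t) - b| <= pi / 2.
Proof.
move=> t1; apply: (@halfplane_stay (fun s => a (s, t)) (fun s => f (s, t))).
  move=> s; apply: (@continuous_comp _ _ _ (fun s : R => (s, t)) a); last exact: ca.
  by move: s; apply: continuous_pair => x; [exact: cvg_id|exact: cvg_cst].
by move=> s s1; exact: da.
Qed.

Lemma vertical_side s b : 0 <= s <= 1 ->
  (forall t, 0 <= t <= 1 -> 0 <= (f (s, t)).1 * cos b + (f (s, t)).2 * sin b) ->
  `|a (s, 0) - b| <= pi / 2 -> `|a (s, 1) - b| <= pi / 2.
Proof.
move=> s1; apply: (@halfplane_stay (fun t => a (s, t)) (fun t => f (s, t))).
  move=> t; apply: (@continuous_comp _ _ _ (fun t : R => (s, t)) a); last exact: ca.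
  by move: t; apply: continuous_pair => x; [exact: cvg_cst|exact: cvg_id].
by move=> t t1; exact: da.
Qed.
End Sides.

Lemma cosNpihalf : cos (- (pi / 2)) = 0 :> R. Proof. by rewrite cosN cos_pihalf. Qed.
Lemma sinNpihalf : sin (- (pi / 2)) = -1 :> R. Proof. by rewrite sinN sin_pihalf. Qed.
Lemma cos3pihalf : cos (pi + pi / 2) = 0 :> R.
Proof. by rewrite addrC cosDpi cos_pihalf oppr0. Qed.
Lemma sin3pihalf : sin (pi + pi / 2) = -1 :> R.
Proof. by rewrite addrC sinDpi sin_pihalf. Qed.

Definition disjoint_curves g d :=
  forall s t : R, 0 <= s <= 1 -> 0 <= t <= 1 -> g s != d t.

Lemma difference_angle g d o : continuous g -> continuous d -> disjoint_curves g d ->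
  directed (g 0 - d 0) o ->
  exists a : R * R -> R, [/\ continuous a, a (0, 0) = o & forall s t,
    0 <= s <= 1 -> 0 <= t <= 1 -> directed (g s - d t) (a (s, t))].
Proof.
move=> cg cd gd do0.
have [|||a [ca a0 da]] := @angle_lift R (fun p => g p.1 - d p.2) o => //.
- move=> p; apply: cvgB.
    by apply: (@continuous_comp _ _ _ fst g); [exact: cvg_fst|exact: cg].
  by apply: (@continuous_comp _ _ _ snd d); [exact: cvg_snd|exact: cd].
- by move=> [s t] [/=]; rewrite !in_itv /= subr_eq0; exact: gd.
by exists a; split => // s t s1 t1; apply: (da (s, t)); exact: squareE.
Qed.

Definition in_strip g := forall t : R, 0 <= t <= 1 -> strip R (g t).

(** Along the boundary of the square of parameters, the vector [g s - d t]
    goes from the negative x-axis at (0, 0) to the positive x-axis at (1, 1)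
    through the upper half plane on one side and the lower half plane on the
    other.  The argument at (1, 1), starting from pi at (0, 0), would thus be in
    [0, pi] and in [pi, 2 pi], hence equal to pi, although the vector
    points to the right there. *)
Lemma swapped_crosscuts_meet g d (x0 x1 y0 y1 : R) : continuous g -> continuous d ->
  in_strip g -> in_strip d ->
  g 0 = (x0, -1) -> g 1 = (x1, 1) -> d 0 = (y0, -1) -> d 1 = (y1, 1) ->
  x0 < y0 -> y1 < x1 -> ~ disjoint_curves g d.
Proof.
move=> cg cd sg sd g0 g1 d0 d1 xy yx gd.
have p0 := pi_gt0 R; have i0 := unit_itv0; have i1 := unit_itv1.
have [|a [ca a0 da]] := @difference_angle g d pi cg cd gd.
  exists (y0 - x0); first by rewrite subr_gt0.
  by rewrite g0 d0 cospi sinpi mulr0 mulrN1 opprB; congr pair; rewrite /= subrr.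
have up0 : `|a (1, 0) - pi / 2| <= pi / 2.
  apply: (horizontal_side (f := fun p => g p.1 - d p.2) ca da i0).
    move=> s s1; rewrite cos_pihalf sin_pihalf mulr0 mulr1 add0r /= d0 /=.
    by have /andP[] := sg _ s1; rewrite opprK; lra.
  by rewrite a0 ler_norml; lra.
have up1 : `|a (1, 1) - pi / 2| <= pi / 2.
  apply: (vertical_side (f := fun p => g p.1 - d p.2) ca da i1) => // t t1.
  rewrite cos_pihalf sin_pihalf mulr0 mulr1 add0r /= g1 /=.
  by have /andP[] := sd _ t1; lra.
have dn0 : `|a (0, 1) - (pi + pi / 2)| <= pi / 2.
  apply: (vertical_side (f := fun p => g p.1 - d p.2) ca da i0).
    move=> t t1; rewrite cos3pihalf sin3pihalf mulr0 mulrN1 add0r /= g0 /=.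
    by have /andP[] := sd _ t1; lra.
  by rewrite a0 ler_norml; lra.
have dn1 : `|a (1, 1) - (pi + pi / 2)| <= pi / 2.
  apply: (horizontal_side (f := fun p => g p.1 - d p.2) ca da i1) => // s s1.
  rewrite cos3pihalf sin3pihalf mulr0 mulrN1 add0r /= d1 /=.
  by have /andP[] := sg _ s1; lra.
have a1 : a (1, 1) = pi.
  by move: up1 dn1; rewrite !ler_norml => /andP[? ?] /andP[? ?]; lra.
have := directed_cos (da _ _ i1 i1); rewrite g1 d1 a1 cospi /=; lra.
Qed.

(** As before, with the end points of both paths on the lower side: the vector
    [g s - d t] is in the upper half plane on the sides where t is constant and in
    the lower one on the sides where s is constant, so that its argument goes from
    pi to 0 and on to [-pi, 0] one way around, and from pi to pi and on to [0, pi]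
    the other way.  At (1, 1) this leaves only 0, although the vector points to the
    left there. *)
Lemma linked_arcs_meet g d (x0 x1 y0 y1 : R) : continuous g -> continuous d ->
  in_strip g -> in_strip d ->
  g 0 = (x0, -1) -> g 1 = (x1, -1) -> d 0 = (y0, -1) -> d 1 = (y1, -1) ->
  x0 < y0 -> y0 < x1 -> x1 < y1 -> ~ disjoint_curves g d.
Proof.
move=> cg cd sg sd g0 g1 d0 d1 xy yx xy1 gd.
have p0 := pi_gt0 R; have i0 := unit_itv0; have i1 := unit_itv1.
have [|a [ca a0 da]] := @difference_angle g d pi cg cd gd.
  exists (y0 - x0); first by rewrite subr_gt0.
  by rewrite g0 d0 cospi sinpi mulr0 mulrN1 opprB; congr pair; rewrite /= subrr.
have up0 : `|a (1, 0) - pi / 2| <= pi / 2.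
  apply: (horizontal_side (f := fun p => g p.1 - d p.2) ca da i0).
    move=> s s1; rewrite cos_pihalf sin_pihalf mulr0 mulr1 add0r /= d0 /=.
    by have /andP[] := sg _ s1; rewrite opprK; lra.
  by rewrite a0 ler_norml; lra.
have a10 : a (1, 0) <= pi / 2.
  rewrite leNgt; apply/negP => h.
  have /cos_lt0 : pi / 2 < a (1, 0) <= pi.
    by move: up0; rewrite ler_norml => /andP[? ?]; lra.
  rewrite ltNge -(directed_cos (da _ _ i1 i0)) g1 d0 /=; lra.
have a10' : a (1, 0) <= 0.
  rewrite leNgt; apply/negP => h.
  have /sin_gt0_pi : 0 < a (1, 0) < pi by lra.
  by rewrite -(directed_sin_gt (da _ _ i1 i0)) g1 d0 /= subrr ltxx.
have a11 : `|a (1, 1) - - (pi / 2)| <= pi / 2.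
  apply: (vertical_side (f := fun p => g p.1 - d p.2) ca da i1).
    move=> t t1; rewrite cosNpihalf sinNpihalf mulr0 mulrN1 add0r /= g1 /=.
    by have /andP[] := sd _ t1; lra.
  by move: up0; rewrite !ler_norml => /andP[? ?]; lra.
have dn0 : `|a (0, 1) - (pi + pi / 2)| <= pi / 2.
  apply: (vertical_side (f := fun p => g p.1 - d p.2) ca da i0).
    move=> t t1; rewrite cos3pihalf sin3pihalf mulr0 mulrN1 add0r /= g0 /=.
    by have /andP[] := sd _ t1; lra.
  by rewrite a0 ler_norml; lra.
have a01 : a (0, 1) <= pi.
  rewrite leNgt; apply/negP => h.
  move: dn0; rewrite ler_norml => /andP[h1 h2].
  have [h3|h3] := ltP (a (0, 1)) (pi + pi).
    have /sin_gt0_pi : 0 < a (0, 1) - pi < pi by lra.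
    have -> : sin (a (0, 1) - pi) = - sin (a (0, 1)).
      by rewrite -{2}(subrK pi (a (0, 1))) sinDpi opprK.
    have := directed_sin (da _ _ i0 i1); rewrite g0 d1 /= subrr lexx.
    by move=> /esym ?; lra.
  have := directed_cos (da _ _ i0 i1).
  have -> : a (0, 1) = pi *+ 2 by rewrite mulr2n; lra.
  by rewrite cos2pi g0 d1 /=; lra.
have up1 : `|a (1, 1) - pi / 2| <= pi / 2.
  apply: (horizontal_side (f := fun p => g p.1 - d p.2) ca da i1).
    move=> s s1; rewrite cos_pihalf sin_pihalf mulr0 mulr1 add0r /= d1 /=.
    by have /andP[] := sg _ s1; rewrite opprK; lra.
  by move: dn0; rewrite !ler_norml => /andP[? ?]; lra.
have a1 : a (1, 1) = 0.
  by move: up1 a11; rewrite !ler_norml => /andP[? ?] /andP[? ?]; lra.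
have := directed_cos (da _ _ i1 i1); rewrite g1 d1 a1 cos0 /=; lra.
Qed.

(** Here the direction of [g s - d t] is to the right for t = 0 and to the left
    for t = 1, downwards for s = 0 and upwards for s = 1, so it makes a full
    turn. *)
Lemma crosscut_separates g d (x0 x1 l r : R) : continuous g -> continuous d ->
  in_strip g -> in_strip d ->
  g 0 = (x0, -1) -> g 1 = (x1, 1) ->
  (forall t, 0 <= t <= 1 -> l < (g t).1 < r) ->
  (d 0).1 <= l -> r <= (d 1).1 -> ~ disjoint_curves g d.
Proof.
move=> cg cd sg sd g0 g1 lgr dl dr gd.
have p0 := pi_gt0 R; have i0 := unit_itv0; have i1 := unit_itv1.
have u0 s : 0 <= s <= 1 -> 0 < (g s - d 0).1 by move=> /lgr /andP[? ?] /=; lra.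
have u1 s : 0 <= s <= 1 -> (g s - d 1).1 < 0 by move=> /lgr /andP[? ?] /=; lra.
have v0 t : 0 <= t <= 1 -> (g 0 - d t).2 <= 0.
  by move=> /sd/andP[? ?] /=; rewrite g0 /=; lra.
have v1 t : 0 <= t <= 1 -> 0 <= (g 1 - d t).2.
  by move=> /sd/andP[? ?] /=; rewrite g1 /=; lra.
pose o := 0 + turn (1, 0) (g 0 - d 0).
have do0 : directed (g 0 - d 0) o.
  apply: directed_turn; first by rewrite /= mulr1 mulr0 addr0 u0.
  by exists 1 => //; rewrite cos0 sin0 mulr1 mulr0.
have oh : - (pi / 2) < o < pi / 2.
  by rewrite /o add0r /turn atan_gtNpi2 atan_ltpi2.
have ole0 : o <= 0.
  rewrite leNgt; apply/negP => h.
  have /sin_gt0_pi : 0 < o < pi by lra.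
  by rewrite -(directed_sin_gt do0) ltNge v0.
have [a [ca a0 da]] := difference_angle cg cd gd do0.
have a01 : `|a (0, 1) - - (pi / 2)| <= pi / 2.
  apply: (vertical_side (f := fun p => g p.1 - d p.2) ca da i0).
    by move=> t t1; rewrite cosNpihalf sinNpihalf mulr0 mulrN1 add0r oppr_ge0 v0.
  by rewrite a0 ler_norml; lra.
have a01' : a (0, 1) <= - (pi / 2).
  rewrite leNgt; apply/negP => h.
  have /cos_ge0_pihalf : - (pi / 2) <= a (0, 1) <= pi / 2.
    by move: a01; rewrite ler_norml => /andP[? ?]; lra.
  by rewrite -(directed_cos (da _ _ i0 i1)) leNgt u1.
have a11 : `|a (1, 1) - - pi| <= pi / 2.
  apply: (horizontal_side (f := fun p => g p.1 - d p.2) ca da i1).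
    by move=> s s1; rewrite cosN cospi sinN sinpi oppr0 mulr0 mulrN1 addr0 oppr_ge0 ltW ?u1.
  by move: a01; rewrite !ler_norml => /andP[? ?]; lra.
have a10 : `|a (1, 0) - 0| <= pi / 2.
  apply: (horizontal_side (f := fun p => g p.1 - d p.2) ca da i0).
    by move=> s s1; rewrite cos0 sin0 mulr0 mulr1 addr0 ltW ?u0.
  by rewrite a0 ler_norml; lra.
have a10' : 0 <= a (1, 0).
  rewrite leNgt; apply/negP => h.
  have /sin_gt0_pi : 0 < - a (1, 0) < pi.
    by move: a10; rewrite ler_norml => /andP[? ?]; lra.
  rewrite sinN oppr_gt0 ltNge -(directed_sin (da _ _ i1 i0)).
  by rewrite v1.
have a11' : `|a (1, 1) - pi / 2| <= pi / 2.
  apply: (vertical_side (f := fun p => g p.1 - d p.2) ca da i1).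
    by move=> t t1; rewrite cos_pihalf sin_pihalf mulr0 mulr1 add0r v1.
  by move: a10; rewrite !ler_norml => /andP[? ?]; lra.
move: a11 a11'; rewrite !ler_norml => /andP[_ ?] /andP[? _].
suff : pi < 0 :> R by rewrite ltNge ltW.
lra.
Qed.

End Crossing.

(** * The strip as a covering of the Moebius strip *)
Section Cover.
Variable R : realType.
Implicit Types (p q : R * R) (k l : int).

Definition sgn k : R := (-1) ^ k.

Lemma sgnD k l : sgn (k + l) = sgn k * sgn l.
Proof. by rewrite /sgn expfzDr// oppr_eq0 oner_eq0. Qed.

Lemma int_parity k : exists m : int, k = 2 * m \/ k = 2 * m + 1.
Proof. by exists (k %/ 2)%Z; lia. Qed.

Lemma sgn0 : sgn 0 = 1. Proof. by rewrite /sgn expr0z. Qed.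
Lemma sgn1 : sgn 1 = -1. Proof. by rewrite /sgn expr1z. Qed.

Lemma sgn_nat (n : nat) : sgn n = (-1) ^+ odd n.
Proof. by rewrite signr_odd. Qed.

Lemma sgnN k : sgn (- k) = sgn k.
Proof. by rewrite /sgn -exprz_inv invrN1. Qed.

Lemma sgnE k : sgn k = (-1) ^+ odd `|k|%N.
Proof. by case: (intP k) => [|n|n]; rewrite ?sgnN ?abszN sgn_nat. Qed.

Lemma sgn_cases k : sgn k = 1 \/ sgn k = -1.
Proof. by rewrite sgnE; case: odd; [right|left]. Qed.

Lemma sgn_sqr k : sgn k * sgn k = 1.
Proof. by case: (sgn_cases k) => ->; rewrite ?mulrNN mulr1. Qed.

Lemma sgn_even k : sgn (2 * k) = 1.
Proof. by rewrite mulr_natl mulr2n sgnD sgn_sqr. Qed.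

Lemma sgn_odd k : sgn (2 * k + 1) = -1.
Proof. by rewrite sgnD sgn_even sgn1 mul1r. Qed.

Lemma cos_sgn k : cos (pi * k%:~R) = sgn k.
Proof.
have hn (n : nat) : cos (pi * n%:R) = sgn n.
  elim: n => [|n IH]; first by rewrite mulr0 cos0 sgn0.
  by rewrite -natr1 mulrDr mulr1 cosDpi IH !sgn_nat /=; case: odd; rewrite /= ?opprK.
by case: (intP k) => [|n|n]; rewrite -?hn ?mulr0 ?cos0 ?sgn0// sgnN -hn mulrNz mulrN cosN.
Qed.

Lemma sin_sgn k : sin (pi * k%:~R) = 0 :> R.
Proof.
have := cos2Dsin2 (pi * k%:~R : R); rewrite cos_sgn expr2 sgn_sqr => h.
by apply/eqP; rewrite -sqrf_eq0; apply/eqP; lra.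
Qed.

Lemma angle_eq (a b : R) : cos a = cos b -> sin a = sin b ->
  exists k, a = b + pi *+ 2 * k%:~R.
Proof.
move=> cab sab.
have c1 : cos (a - b) = 1 by rewrite cosB cab sab -!expr2 cos2Dsin2.
have p0 := pi_gt0 R.
pose k := Num.floor ((a - b) / (pi *+ 2)); exists k.
have p2 : 0 < pi *+ 2 :> R by rewrite mulrn_wgt0.
have /andP[k1 k2] : k%:~R <= (a - b) / (pi *+ 2) < (k + 1)%:~R by exact: floor_itv.
move: k1 k2; rewrite ler_pdivlMr// ltr_pdivrMr// => k1 k2.
pose y := a - b - k%:~R * (pi *+ 2).
have cy : cos y = 1.
  rewrite /y cosB c1.
  have -> : k%:~R * (pi *+ 2) = pi * (2 * k)%:~R :> R by rewrite rmorphM /= mulr2n; ring.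
  by rewrite cos_sgn sin_sgn sgn_even mulr1 mulr0 addr0.
have y0 : 0 <= y by rewrite subr_ge0.
have y2 : y < pi *+ 2.
  by move: k2; rewrite rmorphD /= mulrDl mul1r -ltrBlDl.
suff y00 : y = 0 by rewrite [_ * k%:~R]mulrC; apply/eqP; rewrite -subr_eq0 opprD addrA -/y y00.
apply/eqP; rewrite eq_le y0 andbT leNgt; apply/negP => yp.
have h z : 0 < z <= pi -> cos z < 1 :> R.
  by move=> z0; rewrite -[X in _ < X]cos0 ltr_cos ?in_itv/=; lra.
have [ylp|ylp] := leP y pi.
  by have := h y; rewrite yp ylp cy ltxx => /(_ isT).
have : cos (pi *+ 2 - y) < 1 by apply: h; move: y2 ylp; rewrite mulr2n; lra.
by rewrite cosB cos2pi sin2pi mul1r mul0r addr0 cy ltxx.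
Qed.

Definition deck k p : R * R := (p.1 + k%:~R, sgn k * p.2).

Lemma deckD k l p : deck k (deck l p) = deck (k + l) p.
Proof. by rewrite /deck /= sgnD mulrA rmorphD /= -addrA [l%:~R + _]addrC. Qed.

Lemma deck0 p : deck 0 p = p.
Proof. by case: p => x y; rewrite /deck /= sgn0 mul1r addr0. Qed.

Lemma deckK k : cancel (deck k) (deck (- k)).
Proof. by move=> p; rewrite deckD addNr deck0. Qed.

Lemma strip_deck k p : strip R p -> strip R (deck k p).
Proof.
rewrite /strip /deck /= => /andP[h1 h2].
by case: (sgn_cases k) => ->; rewrite ?mulN1r ?mul1r ?h1 ?h2//; apply/andP; lra.
Qed.

(** The retraction onto the strip extends the projection to the whole plane,
    where convex combinations are available. *)
Definition yclamp (p : R * R) : R * R := (p.1, Num.max (-1) (Num.min 1 p.2)).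

Lemma strip_yclamp p : strip R (yclamp p).
Proof.
by rewrite /strip /yclamp /= le_max lexx ge_max ge_min lexx /= andbT; lra.
Qed.

Lemma yclampE p : strip R p -> yclamp p = p.
Proof.
by case: p => x y /andP[h1 h2]; rewrite /yclamp /= (min_idPr h2) (max_idPr h1).
Qed.

Definition pr p : moebius R := to_moebius (exist _ (yclamp p) (mem_set (strip_yclamp p))).

Lemma prE (p : strip R) : to_moebius p = pr (val p).
Proof.
case: p => p hp; rewrite /pr; congr to_moebius; apply: val_inj.
by apply/esym/yclampE/set_mem.
Qed.

Lemma pr_surj (m : moebius R) : exists2 p, strip R p & pr p = m.
Proof.
exists (val (repr m)); first by case: (repr m) => p hp; exact: set_mem hp.
by rewrite -prE /to_moebius reprK.
Qed.

Lemma pr_eqP p q : strip R p -> strip R q ->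
  pr p = pr q <-> exists k, q = deck k p.
Proof.
move=> sp sq; have h : pr p = pr q <-> deck_rel (exist _ (yclamp p) (mem_set (strip_yclamp p)))
   (exist _ (yclamp q) (mem_set (strip_yclamp q))).
  by split => [/eqmodP//|/eqmodP].
have yE r : strip R r -> Num.max (-1) (Num.min 1 r.2) = r.2.
  by move=> sr; rewrite -[in RHS](yclampE sr).
rewrite h; split.
  move=> /asboolP[k]; rewrite /= !yE// => -[h1 h2]; exists k.
  by case: q h1 h2 {sq h} => x y /= -> ->.
by move=> [k qE]; apply/asboolP; exists k; rewrite /= !yE// qE.
Qed.

Lemma pr_deck k p : strip R p -> pr (deck k p) = pr p.
Proof.
by move=> sp; apply/esym/pr_eqP => //; [exact: strip_deck|exists k].
Qed.

Lemma continuous_pr : continuous pr.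
Proof.
pose s p : strip R := exist _ (yclamp p) (mem_set (strip_yclamp p)).
have cs : continuous s.
  apply: continuous_comp_initial.
  have -> : set_val \o s = yclamp by apply/funext.
  apply: continuous_pair => p; first exact: cvg_fst.
  apply: (@continuous_max R _ (cst (-1)) (fun p : R * R => Num.min 1 p.2)).
    exact: cst_continuous.
  by apply: (@continuous_min R _ (cst 1) snd); [exact: cst_continuous|exact: cvg_snd].
move=> p; apply: (@continuous_comp _ _ _ s (@to_moebius R)); first exact: cs.
exact: pi_continuous.
Qed.

(** Functions on the quotient are invariant functions on the strip; this holds
    for functions on the plane because a point and its representative differ by
    a deck transformation. *)
Lemma moebius_fun (T : topologicalType) (h : R * R -> T) : continuous h ->
  (forall k p, h (deck k p) = h p) ->
  exists2 hm : moebius R -> T, continuous hm & forall p, strip R p -> hm (pr p) = h p.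
Proof.
move=> ch hd; exists (fun m => h (val (repr m))).
  apply: (@repr_comp_continuous _ _ _ (fun p : strip R => h (val p))).
    move=> p; apply: (@continuous_comp _ _ _ (set_val : strip R -> R * R) h); last exact: ch.
    exact: initial_continuous.
  move=> a b /eqP/eqmodP /asboolP[k [h1 h2]].
  have -> : val b = deck k (val a) by rewrite [LHS]surjective_pairing h1 h2.
  by rewrite hd.
move=> p sp; have : pr (val (repr (pr p))) = pr p by rewrite -prE /to_moebius reprK.
have sr : strip R (val (repr (pr p))) by case: (repr _) => q hq; exact: set_mem hq.
by move=> /(pr_eqP sr sp)[k {2}->]; rewrite hd.
Qed.

End Cover.

(** * Lifting paths and homotopies *)
Section Lifting.
Variable R : realType.
Implicit Types (p q : R * R) (k l : int) (g h : R -> moebius R) (L M : R -> R * R).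

(** [circle_coord] is exp(2 pi i x) and [twisted_coord] is y exp(pi i x).  Both
    are invariant under the glide reflection, and together they determine the
    point of the Moebius strip. *)
Definition circle_coord p : R * R := (cos (pi *+ 2 * p.1), sin (pi *+ 2 * p.1)).
Definition twisted_coord p : R * R := (p.2 * cos (pi * p.1), p.2 * sin (pi * p.1)).

Lemma circle_coord_deck k p : circle_coord (deck k p) = circle_coord p.
Proof.
rewrite /circle_coord /= mulrDr.
have -> : pi *+ 2 * k%:~R = pi * (2 * k)%:~R :> R.
  by rewrite rmorphM /= mulr2n; ring.
by rewrite cosD sinD cos_sgn sin_sgn sgn_even !mulr0 !mulr1 subr0 addr0.
Qed.

Lemma twisted_coord_deck k p : twisted_coord (deck k p) = twisted_coord p.
Proof.
rewrite /twisted_coord /= mulrDr cosD sinD cos_sgn sin_sgn !mulr0 subr0 addr0.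
have := sgn_sqr R k; move: (sgn R k) (cos _) (sin _) => e C S e1.
by congr pair; rewrite -[RHS]mul1r -e1; ring.
Qed.

Lemma continuous_cosf (T : topologicalType) (u : T -> R) :
  continuous u -> continuous (fun t => cos (u t)).
Proof. by move=> cu t; apply: (@continuous_comp _ _ _ u (@cos R)); [exact: cu|exact: continuous_cos]. Qed.

Lemma continuous_sinf (T : topologicalType) (u : T -> R) :
  continuous u -> continuous (fun t => sin (u t)).
Proof. by move=> cu t; apply: (@continuous_comp _ _ _ u (@sin R)); [exact: cu|exact: continuous_sin]. Qed.

Lemma continuous_mulf (T : topologicalType) (u v : T -> R) :
  continuous u -> continuous v -> continuous (fun t => u t * v t).
Proof. by move=> cu cv t; apply: cvgM; [exact: cu|exact: cv]. Qed.

Lemma continuous_addf (T : topologicalType) (u v : T -> R) :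
  continuous u -> continuous v -> continuous (fun t => u t + v t).
Proof. by move=> cu cv t; apply: cvgD; [exact: cu|exact: cv]. Qed.

Lemma continuous_scalef (T : topologicalType) (a : R) (u : T -> R) :
  continuous u -> continuous (fun t => a * u t).
Proof. by move=> cu t; apply: cvgM; [exact: cvg_cst|exact: cu]. Qed.

Lemma continuous_circle_coord : continuous circle_coord.
Proof.
by apply: continuous_pair; [apply: continuous_cosf|apply: continuous_sinf];
  apply: continuous_scalef => p; exact: cvg_fst.
Qed.

Lemma continuous_twisted_coord : continuous twisted_coord.
Proof.
apply: continuous_pair; apply: continuous_mulf; (try by move=> p; exact: cvg_snd);
  [apply: continuous_cosf|apply: continuous_sinf];
  by apply: continuous_scalef => p; exact: cvg_fst.
Qed.

(** The x-coordinate of the lift is a continuous argument of [circle_coord]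
    divided by 2 pi; then y is recovered from [twisted_coord] by multiplying with
    exp(- pi i x).  No local sections of the covering are needed. *)
Lemma lift_square (H : R * R -> moebius R) p0 : continuous H ->
  strip R p0 -> pr p0 = H (0, 0) ->
  exists L : R * R -> R * R, [/\ continuous L, L (0, 0) = p0 &
    forall p, square p -> strip R (L p) /\ pr (L p) = H p].
Proof.
move=> cH sp0 pH0.
have p0' := pi_gt0 R.
have [c cc cE] := moebius_fun continuous_circle_coord circle_coord_deck.
have [w cw wE] := moebius_fun continuous_twisted_coord twisted_coord_deck.
have pi2 : pi *+ 2 != 0 :> R by rewrite mulrn_eq0/= gt_eqF.
have [|||a [ca a0 da]] := @angle_lift R (c \o H) (pi *+ 2 * p0.1).
- by move=> p; apply: continuous_comp; [exact: cH|exact: cc].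
- move=> p _ /=; have [q sq <-] := pr_surj (H p); rewrite cE// /circle_coord.
  apply/eqP => -[h1 h2]; have := cos2Dsin2 (pi *+ 2 * q.1).
  by rewrite h1 h2 !expr0n/= addr0 => /eqP; rewrite eq_sym oner_eq0.
- by rewrite /= -pH0 cE//; exists 1 => //; rewrite !mul1r.
pose X p := a p / (pi *+ 2).
pose L p := (X p, (w (H p)).1 * cos (pi * X p) + (w (H p)).2 * sin (pi * X p)).
have key p q k : strip R q -> pr q = H p -> a p = pi *+ 2 * q.1 + pi *+ 2 * k%:~R ->
    L p = deck k q.
  move=> sq qH ap; rewrite /L /deck; have -> : X p = q.1 + k%:~R.
    by rewrite /X ap -mulrDr mulrC mulKf.
  congr pair; rewrite -qH wE// /twisted_coord /= mulrDr cosD sinD cos_sgn sin_sgn.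
  have := cos2Dsin2 (pi * q.1); move: (cos _) (sin _) (sgn _ _) => C S e CS.
  transitivity (e * q.2 * (C ^+ 2 + S ^+ 2)); last by rewrite CS mulr1.
  ring.
exists L; split.
- have cX : continuous X by move=> p; apply: cvgM; [exact: ca|exact: cvg_cst].
  have cwH : continuous (w \o H) by move=> p; apply: continuous_comp; [exact: cH|exact: cw].
  apply: continuous_pair => //; apply: continuous_addf; apply: continuous_mulf.
  + exact: (continuous_fst cwH).
  + by apply: continuous_cosf; exact: continuous_scalef.
  + exact: (continuous_snd cwH).
  + by apply: continuous_sinf; exact: continuous_scalef.
- by rewrite (key _ p0 0)// ?deck0// a0 mulr0 addr0.
- move=> p sp; have [q sq qH] := pr_surj (H p).
  have [r r0] := da _ sp; rewrite /= -qH cE// /circle_coord => -[h1 h2].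
  have r1 : r = 1.
    have : r ^+ 2 * (cos (a p) ^+ 2 + sin (a p) ^+ 2) = 1.
      by rewrite mulrDr -!exprMn -h1 -h2 cos2Dsin2.
    by rewrite cos2Dsin2 mulr1 => /eqP; rewrite sqrp_eq1 ?ltW// => /eqP.
  move: h1 h2; rewrite r1 !mul1r => /esym h1 /esym h2.
  have [k ak] := angle_eq h1 h2.
  by rewrite (key p q k)// pr_deck//; split => //; exact: strip_deck.
Qed.

Definition lifts L g := [/\ continuous L, in_strip L &
  forall t, 0 <= t <= 1 -> pr (L t) = g t].

Lemma lifts_deck k L g : lifts L g -> lifts (fun t => deck k (L t)) g.
Proof.
case=> cL sL Lg; split.
- apply: continuous_pair; first by apply: continuous_addf; [exact: continuous_fst|exact: cst_continuous].
  by apply: continuous_scalef; exact: continuous_snd.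
- by move=> t t1; apply/strip_deck/sL.
- by move=> t t1; rewrite pr_deck ?Lg//; exact: sL.
Qed.

Lemma lifts_reverse L g : lifts L g -> lifts (fun t => L (1 - t)) (reverse g).
Proof.
case=> cL sL Lg.
have f (t : R) : 0 <= t <= 1 -> 0 <= 1 - t <= 1 by move=> /andP[? ?]; apply/andP; lra.
split.
- move=> t; apply: (@continuous_comp _ _ _ (fun t : R => 1 - t) L); last exact: cL.
  by apply: cvgB; [exact: cvg_cst|exact: cvg_id].
- by move=> t /f; exact: sL.
- by move=> t /f; exact: Lg.
Qed.

Lemma continuous_clamp_comp (T : topologicalType) (g : R -> T) :
  {within `[0, 1], continuous g} -> continuous (g \o @clamp R).
Proof.
move=> /subspace_continuousP cg t.
have ct : `[0, 1]%classic (clamp t) by rewrite /= in_itv /= clampP.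
move=> A /(cg _ ct) h.
have := continuous_clamp (h : nbhs (clamp t) (fun x => `[0, 1]%classic x -> A (g x))).
rewrite /nbhs /=; apply: (@filterS _ (nbhs t) _) => x; apply.
by rewrite /= in_itv /= clampP.
Qed.

Lemma continuous_clamp2_comp (T : topologicalType) (H : R * R -> T) :
  {within `[0, 1] `*` `[0, 1], continuous H} -> continuous (H \o @clamp2 R).
Proof.
move=> /subspace_continuousP cH t.
move=> A /(cH _ (square_clamp2 t)) h.
have := continuous_clamp2 (h : nbhs (clamp2 t) (fun x => square x -> A (H x))).
rewrite /nbhs /=; apply: (@filterS _ (nbhs t) _) => x; apply.
exact: square_clamp2.
Qed.

Lemma path_lift g p0 : {within `[0, 1], continuous g} ->
  strip R p0 -> pr p0 = g 0 -> exists2 L, lifts L g & L 0 = p0.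
Proof.
move=> cg sp0 gp0.
have c1 : continuous (fun p : R * R => g (clamp p.1)).
  by move=> p; apply: (@continuous_comp _ _ _ fst (g \o @clamp R));
    [exact: cvg_fst|exact: continuous_clamp_comp].
have [|L [cL L0 LP]] := lift_square c1 sp0.
- by rewrite /= clampE ?unit_itv0.
exists (fun t => L (t, 0)) => //; split.
- move=> t; apply: (@continuous_comp _ _ _ (fun t : R => (t, 0 : R)) L); last exact: cL.
  by move: t; apply: continuous_pair => x; [exact: cvg_id|exact: cvg_cst].
- by move=> t t1; have [] := LP _ (squareE t1 (unit_itv0 R)).
- by move=> t t1; have [_ ->] := LP _ (squareE t1 (unit_itv0 R)); rewrite /= clampE.
Qed.

(** The difference of the x-coordinates is continuous with integer values. *)
Lemma lift_unique L M g : lifts L g -> lifts M g ->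
  exists k, forall t, 0 <= t <= 1 -> M t = deck k (L t).
Proof.
move=> [cL sL Lg] [cM sM Mg].
have h t : 0 <= t <= 1 -> exists k, M t = deck k (L t).
  by move=> t1; apply/(pr_eqP (sL _ t1) (sM _ t1)); rewrite Lg// Mg.
have [k0 E0] := h 0 (unit_itv0 R).
exists k0 => t t1; have [k Ek] := h t t1; rewrite Ek.
case: (eqVneq k k0) => [->//|kk0]; exfalso.
pose f (u : R) := (M u).1 - (L u).1.
have cf : continuous f.
  by move=> u; apply: cvgB; [exact: (continuous_fst cM)|exact: (continuous_fst cL)].
have f0 : f 0 = k0%:~R by rewrite /f E0 /= addrC addKr.
have ft : f t = k%:~R by rewrite /f Ek /= addrC addKr.
have [t0 t1'] := andP t1.
pose k' := Num.min k k0.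
(* Two different integers have a half-integer between them. *)
have [||c c01 fc] := @IVT R f 0 t (k'%:~R + 1 / 2) t0.
- exact: continuous_subspaceT.
- rewrite f0 ft ge_min le_max /k'.
  have [lk|lk] : (k + 1 <= k0) \/ (k0 + 1 <= k) by lia.
    rewrite (min_idPl _); last by lia.
    have : ((k + 1)%:~R : R) <= k0%:~R by rewrite ler_int.
    by rewrite rmorphD /= => ?; apply/andP; split; apply/orP; [right|left]; lra.
  rewrite (min_idPr _); last by lia.
  have : ((k0 + 1)%:~R : R) <= k%:~R by rewrite ler_int.
  by rewrite rmorphD /= => ?; apply/andP; split; apply/orP; [left|right]; lra.
have c01' : 0 <= c <= 1.
  by move: c01; rewrite in_itv/= => /andP[-> /le_trans->].
have [l El] := h c c01'.
move: fc; rewrite /f El /= addrC addKr => lE.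
have : ((2 * l)%:~R : R) = (2 * k' + 1)%:~R.
  by rewrite intrD !intrM lE; field.
by move=> /intr_inj; lia.
Qed.

Lemma pr_comp_continuous (T : topologicalType) (L : T -> R * R) :
  continuous L -> continuous (fun t => pr (L t)).
Proof.
by move=> cL t; apply: (@continuous_comp _ _ _ L (@pr R)); [exact: cL|exact: continuous_pr].
Qed.

Definition joins g p q := exists L, [/\ lifts L g, L 0 = p & L 1 = q].

Lemma joins_pr g p q : joins g p q ->
  [/\ strip R p, strip R q, pr p = g 0 & pr q = g 1].
Proof.
case=> L [[cL sL Lg] <- <-].
by split; rewrite ?Lg ?unit_itv0 ?unit_itv1//; apply: sL; rewrite ?unit_itv0 ?unit_itv1.
Qed.

Lemma joins_deck g p q k : joins g p q -> joins g (deck k p) (deck k q).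
Proof.
by case=> L [Lg <- <-]; exists (fun t => deck k (L t)); split => //; exact: lifts_deck.
Qed.

Lemma joins_unique g p q p' q' : joins g p q -> joins g p' q' ->
  exists k, p' = deck k p /\ q' = deck k q.
Proof.
case=> L [Lg <- <-] [M [Mg <- <-]]; have [k h] := lift_unique Lg Mg.
by exists k; rewrite !h ?unit_itv0 ?unit_itv1.
Qed.

Lemma joins_ex g p : {within `[0, 1], continuous g} ->
  strip R p -> pr p = g 0 -> exists q, joins g p q.
Proof.
by move=> cg sp gp; have [L Lg L0] := path_lift cg sp gp; exists (L 1), L.
Qed.

Lemma joins_reverse g p q : joins g p q -> joins (reverse g) q p.
Proof.
case=> L [Lg <- <-]; exists (fun t => L (1 - t)).
by rewrite subr0 subrr; split => //; exact: lifts_reverse.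
Qed.

(** A homotopy lifts, and fixes the end points of the lift since the lift of
    a constant path is constant.  Conversely two lifts with the same end points
    are joined by straight segments, the strip being convex. *)
Lemma homotopic_joins g h p q : joins g p q ->
  homotopic_rel_ends g h <-> joins h p q.
Proof.
move=> jg; have [sp sq gp gq] := joins_pr jg; split.
- case=> H [cH Hgh He].
  have i0 := unit_itv0 R; have i1 := unit_itv1 R.
  have [|L [cL L0 LP]] := lift_square (continuous_clamp2_comp cH) sp.
    by rewrite gp /= clamp2E; [case: (Hgh 0 i0)|exact: squareE].
  have LH s t : 0 <= s <= 1 -> 0 <= t <= 1 -> strip R (L (s, t)) /\ pr (L (s, t)) = H (s, t).
    by move=> s1 t1; have := LP _ (squareE s1 t1); rewrite /= clamp2E//; exact: squareE.
  have cLv s : continuous (fun t => L (s, t)).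
    move=> t; apply: (@continuous_comp _ _ _ (fun t : R => (s, t)) L); last exact: cL.
    by move: t; apply: continuous_pair => x; [exact: cvg_cst|exact: cvg_id].
  have cLh t : continuous (fun s => L (s, t)).
    move=> s; apply: (@continuous_comp _ _ _ (fun s : R => (s, t)) L); last exact: cL.
    by move: s; apply: continuous_pair => x; [exact: cvg_id|exact: cvg_cst].
  have const t m : 0 <= t <= 1 -> (forall s, 0 <= s <= 1 -> H (s, t) = m) ->
      L (1, t) = L (0, t).
    move=> t1 Hm.
    have l1 : lifts (fun s => L (s, t)) (cst m).
      split => // s s1; first by case: (LH s t s1 t1).
      by rewrite -(Hm _ s1); case: (LH s t s1 t1).
    have l2 : lifts (fun s => L (0, t)) (cst m).
      split => [|s s1|s s1]; first exact: cst_continuous.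
        by case: (LH 0 t i0 t1).
      by rewrite -(Hm 0 i0); case: (LH 0 t i0 t1).
    have [k hk] := lift_unique l2 l1.
    rewrite (hk 1 i1); have := hk 0 i0; case: (L (0, t)) => x y [].
    rewrite -[X in X = _]addr0 => /addrI /esym/eqP; rewrite intr_eq0 => /eqP ->.
    by rewrite deck0.
  have jg' : joins g (L (0, 0)) (L (0, 1)).
    exists (fun t => L (0, t)); split => //; split => // t t1.
      by case: (LH 0 t i0 t1).
    by case: (LH 0 t i0 t1) => _ ->; case: (Hgh t t1).
  have [k [e1 e2]] := joins_unique jg jg'.
  have k0 : k = 0.
    move: e1; rewrite L0; case: (p) => x y [].
    by rewrite -[X in X = _]addr0 => /addrI /esym/eqP; rewrite intr_eq0 => /eqP.
  exists (fun t => L (1, t)); split.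
  + split => // t t1; first by case: (LH 1 t i1 t1).
    by case: (LH 1 t i1 t1) => _ ->; case: (Hgh t t1).
  + by rewrite (const 0 (g 0))// => s s1; case: (He s s1).
  + rewrite (const 1 (g 1))//; first by rewrite e2 k0 deck0.
    by move=> s s1; case: (He s s1).
- case: jg => L [[cL sL Lg] L0 L1] [M [[cM sM Mh] M0 M1]].
  exists (fun u => pr ((1 - u.1) *: L u.2 + u.1 *: M u.2)); split.
  + apply: continuous_subspaceT; apply: pr_comp_continuous => u.
    apply: cvgD; apply: cvgZ.
    * by apply: cvgB; [exact: cvg_cst|exact: cvg_fst].
    * by apply: (@continuous_comp _ _ _ snd L); [exact: cvg_snd|exact: cL].
    * exact: cvg_fst.
    * by apply: (@continuous_comp _ _ _ snd M); [exact: cvg_snd|exact: cM].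
  + by move=> t t1 /=; rewrite subr0 subrr !scale1r !scale0r addr0 add0r Lg// Mh.
  + move=> s s1 /=; rewrite L0 M0 L1 M1 -!scalerDl subrK !scale1r.
    by rewrite gp gq.
Qed.

End Lifting.

(** * Subsets that avoid a path across the strip are orientable *)
Section Conn.
Variables (R : realType) (U : set (moebius R)).
Implicit Types (p q r : R * R) (k l : int).

Definition path_in p q := exists c : R -> R * R, [/\ continuous c, c 0 = p, c 1 = q &
  forall t, 0 <= t <= 1 -> strip R (c t) /\ U (pr (c t))].

Lemma path_in_refl p : strip R p -> U (pr p) -> path_in p p.
Proof. by move=> sp Up; exists (cst p); split => //; exact: cst_continuous. Qed.

Lemma path_in_sym p q : path_in p q -> path_in q p.
Proof.
case=> c [cc c0 c1 sU]; exists (fun t => c (1 - t)); rewrite subr0 subrr; split => //.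
  move=> t; apply: (@continuous_comp _ _ _ (fun t : R => 1 - t) c); last exact: cc.
  by apply: cvgB; [exact: cvg_cst|exact: cvg_id].
by move=> t /andP[? ?]; apply: sU; apply/andP; lra.
Qed.

(** The sum of the two paths, run one after the other with the other one at
    rest, minus the common point is their concatenation; it is continuous without
    any gluing. *)
Lemma path_in_trans p q r : path_in p q -> path_in q r -> path_in p r.
Proof.
case=> c [cc c0 c1 cU] [d [cd d0 d1 dU]].
exists (fun t => c (clamp (2 * t + 0)) + d (clamp (2 * t - 1)) - q).
have cl (e : R -> R * R) (a b : R) : continuous e ->
    continuous (fun t : R => e (clamp (a * t + b))).
  move=> ce t.
  apply: (@continuous_comp _ _ _ (fun t : R => clamp (a * t + b)) e); last exact: ce.
  apply: (@continuous_comp _ _ _ (fun t : R => a * t + b) (@clamp R)); last exact: continuous_clamp.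
  by apply: cvgD; [apply: cvgM; [exact: cvg_cst|exact: cvg_id]|exact: cvg_cst].
have c2 := cl c 2 0 cc; have d2 := cl d 2 (-1) cd.
split.
- by move=> t; apply: cvgB; [apply: cvgD; [exact: c2|exact: d2]|exact: cvg_cst].
- by rewrite addr0 mulr0 sub0r !clamp_le0 ?oppr_le0// c0 d0 addrK.
- by rewrite addr0 mulr1 !clamp_ge1 ?c1 ?d1 ?[q + _]addrC ?addrK//; lra.
- move=> t t01; rewrite addr0; have [h|h] := leP t (1 / 2).
    rewrite (@clamp_le0 _ (2 * t - 1)); last lra.
    by rewrite d0 addrK; apply: cU; exact: clampP.
  rewrite (@clamp_ge1 _ (2 * t)); last lra.
  by rewrite c1 addrC addKr; apply: dU; exact: clampP.
Qed.

Lemma path_in_deck k p q : path_in p q -> path_in (deck k p) (deck k q).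
Proof.
case=> c [cc <- <- cU]; exists (fun t => deck k (c t)); split => //.
  apply: continuous_pair.
    by apply: continuous_addf; [exact: continuous_fst|exact: cst_continuous].
  by apply: continuous_scalef; exact: continuous_snd.
by move=> t /cU[st Ut]; rewrite pr_deck//; split => //; exact: strip_deck.
Qed.

Lemma path_in_ends p q : path_in p q ->
  [/\ strip R p, strip R q, U (pr p) & U (pr q)].
Proof.
case=> c [_ <- <- cU].
by have [? ?] := cU 0 (unit_itv0 R); have [? ?] := cU 1 (unit_itv1 R).
Qed.

Lemma path_in_iter k p (m : nat) : path_in p (deck k p) -> path_in p (deck (k * m) p).
Proof.
move=> h; elim: m => [|m IH].
  by rewrite mulr0 deck0; have [? _ ? _] := path_in_ends h; exact: path_in_refl.
apply: (path_in_trans IH); rewrite -[m.+1]addn1 PoszD mulrDr mulr1 -deckD.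
exact: path_in_deck.
Qed.

Lemma path_in_segment p q :
  (forall t, 0 <= t <= 1 -> strip R ((1 - t) *: p + t *: q) /\
      U (pr ((1 - t) *: p + t *: q))) -> path_in p q.
Proof.
move=> h; exists (fun t => (1 - t) *: p + t *: q).
rewrite subr0 subrr !scale0r !scale1r addr0 add0r; split => //.
move=> t; apply: cvgD; apply: cvgZ; (try exact: cvg_cst) => //.
by apply: cvgB; [exact: cvg_cst|exact: cvg_id].
Qed.

Lemma path_in_local p : open U -> strip R p -> U (pr p) ->
  \forall q \near p, strip R q -> path_in p q.
Proof.
move=> oU sp Up.
have /nbhs_ballP[d /= d0 H] : nbhs p (@pr R @^-1` U).
  by apply: continuous_pr; exact: open_nbhs_nbhs.
near=> q => sq.
have pq : ball p d q by near: q; exact: nbhsx_ballx.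
apply: path_in_segment => t /andP[t0 t1]; split.
  move: sp sq; case: (p) (q) => x y [x' y'] /= /andP[h1 h2] /andP[h3 h4].
  have t1' : 0 <= 1 - t by lra.
  have h5 : 0 <= y + 1 by rewrite -lerBlDr sub0r.
  have h6 : 0 <= 1 - y by rewrite subr_ge0.
  have h7 : 0 <= y' + 1 by rewrite -lerBlDr sub0r.
  have h8 : 0 <= 1 - y' by rewrite subr_ge0.
  have := mulr_ge0 t1' h5; have := mulr_ge0 t1' h6.
  have := mulr_ge0 t0 h7; have := mulr_ge0 t0 h8.
  by rewrite /strip /= /GRing.scale /= => ? ? ? ?; apply/andP; lra.
apply: H; move: pq; rewrite -ball_normE /=; apply: le_lt_trans.
have -> : p - ((1 - t) *: p + t *: q) = t *: (p - q).
  by rewrite scalerBl scale1r scalerBr opprD opprB addrA addrCA subrr addr0.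
by rewrite normrZ ger0_norm// ler_piMl.
Unshelve. all: by end_near. Qed.

Hypothesis no_reversing : forall p k, k != 0 -> ~ path_in p (deck k p).

Let C p : set (R * R) := [set q | exists k, path_in p (deck k q)].
Let rep p : R * R := xget 0 (C p).

(** If no component of the preimage of [U] is mapped to itself by a non-trivial
    deck transformation, the components of each orbit are numbered by the
    integers once a base component is chosen, and parity is an orientation: it
    is constant on components and changes under the glide reflection. *)
Lemma orientable_of_no_loop : open U -> orientable U.
Proof.
move=> oU.
have CE p q k : path_in p (deck k q) -> C p = C q.
  move=> h; apply/seteqP; split => r [l hl].
    exists (l - k); have := path_in_trans (path_in_sym h) hl => /(path_in_deck (- k)).
    by rewrite deckK deckD addrC.
  by exists (k + l); rewrite -deckD; apply: path_in_trans h _; exact: path_in_deck.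
have Crep p : strip R p -> U (pr p) -> C p (rep p).
  move=> sp Up; apply: (@xgetPex _ 0 (C p)); exists p, 0; rewrite deck0.
  exact: path_in_refl.
(* [C p] depends only on the orbit of the component of p, hence so does [rep p]. *)
pose E p := exists k, path_in p (deck (2 * k) (rep p)).
have EE p q : path_in p q -> E p -> E q.
  move=> h [k hk]; exists k; rewrite /rep -(CE p q 0) ?deck0//.
  exact: path_in_trans (path_in_sym h) hk.
exists (fun x : strip R => `[< E (val x) >]); split.
- apply/subspace_continuousP => x Ux; apply: cvg_near_cst.
  have sx : strip R (val x) by case: x {Ux} => p hp; exact: set_mem hp.
  have Ux' : U (pr (val x)) by rewrite -prE.
  have h := path_in_local oU sx Ux'.
  have h' : \forall y \near x, strip R (val y) -> path_in (val x) (val y).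
    exact: (@initial_continuous (strip R) (R * R)%type set_val x _ h).
  rewrite /prop_near1 /nbhs /= /within /=; apply: (@filterS _ (nbhs x) _) h' => y hy _.
  have sy : strip R (val y) by case: y {hy} => p hp; exact: set_mem hp.
  have xy := hy sy.
  by apply/asbool_equiv_eq; split; apply: EE => //; exact: path_in_sym.
- move=> p q; rewrite prE => Up q1 q2.
  have sp : strip R (val p) by case: p {Up q1 q2} => p hp; exact: set_mem hp.
  have qE : val q = deck 1 (val p).
    by rewrite [LHS]surjective_pairing q1 q2 /deck sgn1 mulN1r.
  move: (val p) (val q) qE sp Up {q1 q2} => {}p {}q -> sp Up.
  have repE : rep (deck 1 p) = rep p.
    rewrite /rep (CE (deck 1 p) p 1)//.
    by apply: path_in_refl; [exact: strip_deck|rewrite pr_deck].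
  have [k hk] := Crep p sp Up.
  have cancel_rep l m : path_in p (deck l (rep p)) -> path_in p (deck m (rep p)) -> l = m.
    move=> hl hm; apply/eqP; rewrite -subr_eq0; apply/negPn/negP => lm.
    apply: (no_reversing lm (p := rep p)).
    have := path_in_deck (- m) (path_in_trans (path_in_sym hm) hl).
    by rewrite deckK deckD addrC.
  have deck_rep l : path_in (deck 1 p) (deck l (rep p)) <-> path_in p (deck (l - 1) (rep p)).
    split => [/(path_in_deck (- 1))|/(path_in_deck 1)]; first by rewrite deckK deckD addrC.
    by rewrite deckD addrC subrK.
  rewrite /E repE; case: (boolP `[< exists l, path_in p (deck (2 * l) (rep p)) >]).
    move=> /asboolP[l hl]; apply/asboolPn => -[m /deck_rep hm].
    by have := cancel_rep _ _ hl hm; lia.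
  move=> /asboolPn nE; apply/asboolP.
  have [m [km|km]] := int_parity k; first by case: nE; exists m; rewrite -km.
  by exists (m + 1); apply/deck_rep; rewrite (_ : 2 * (m + 1) - 1 = k)//; lia.
Qed.

End Conn.

Section Crosscut.
Variable R : realType.

(** A path in the preimage of [U] from a point to a translate of it can be
    repeated until it leads from far left to far right of a lift of [g], which it
    then has to meet. *)
Lemma crosscut_orientable (g : R -> moebius R) (U : set (moebius R)) (x0 x1 : R) :
  joins g (x0, -1) (x1, 1) -> open U -> (forall t, 0 <= t <= 1 -> ~ U (g t)) ->
  orientable U.
Proof.
case=> L [[cL sL Lg] L0 L1] oU Ug; apply: orientable_of_no_loop => // p k k0.
wlog kp : p k k0 / 0 < k.
  move=> H h; have [kp|kn] : 0 < k \/ 0 < - k by lia.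
    exact: (H p k).
  apply: (H p (- k)) => //; first by rewrite oppr_eq0.
  apply: path_in_sym; have := path_in_deck (- k) h; by rewrite deckK.
move=> h.
have cL1 : {within `[0, 1], continuous (fun t => (L t).1)}.
  by apply: continuous_subspaceT; exact: continuous_fst.
have [tM tM1 hM] := EVT_max ler01 cL1.
have [tm tm1 hm] := EVT_min ler01 cL1.
pose l := (L tm).1 - 1; pose r := (L tM).1 + 1.
(* After m repetitions in both directions, the path overlaps [l, r]. *)
pose m := (Num.truncn (`|p.1 - l| + `|p.1 - r|)).+1.
have mP : `|p.1 - l| + `|p.1 - r| <= m%:R by rewrite ltW// truncnS_gt.
have hk := path_in_iter m h.
have {}h : path_in U (deck (- (k * m)) p) (deck (k * m) p).
  by have := path_in_deck (- (k * m)) hk; rewrite deckK => /path_in_trans; exact.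
have mk : m%:R <= (k * m)%:~R :> R.
  rewrite -[m%:R]/((m : int)%:~R) ler_int.
  by rewrite ler_peMl//; lia.
case: h => d [cd d0 d1 dU].
apply: (@crosscut_separates R L d x0 x1 l r) => //.
- by move=> t t1; have [] := dU t t1.
- move=> t t1; have t1' : t \in `[0, 1]%R by rewrite in_itv.
  by have := hM t t1'; have := hm t t1'; rewrite /l /r => ? ?; apply/andP; lra.
- by rewrite d0 /= mulrNz; move: (ler_norm (p.1 - l)) (normr_ge0 (p.1 - r)); lra.
- rewrite d1 /=; move: (ler_norm (r - p.1)) (normr_ge0 (p.1 - l)).
  by rewrite (distrC r); lra.
- move=> s t s1 t1; apply/eqP => e; apply: (Ug s s1); rewrite -Lg// e.
  by have [] := dU t t1.
Qed.
End Crosscut.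

(** * Lifts of simple arcs *)
Section Arcs.
Variables (R : realType) (n : nat).
Hypothesis n0 : (0 < n)%N.
Implicit Types (p q : R * R) (a b c d k : int) (g h : R -> moebius R) (L M : R -> R * R).

(** The vertices of the lower side of the strip are [bot a] for all integers
    [a].  The index on the upper side is chosen such that the glide reflection
    maps [top a] to [bot a]; it then maps [bot a] to [top (a + n)]. *)
Definition vtx a : R := 2 * a%:~R / n%:R.
Definition bot a : R * R := (vtx a, -1).
Definition top a : R * R := (vtx a - 1, 1).

Lemma nR0 : 0 < n%:R :> R. Proof. by rewrite ltr0n. Qed.

Lemma vtxD a k : vtx (a + k * n) = vtx a + 2 * k%:~R.
Proof.
by have := nR0; rewrite /vtx intrD intrM => h; field; rewrite gt_eqF.
Qed.

Lemma ltr_vtx a b : (vtx a < vtx b) = (a < b).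
Proof. by rewrite /vtx ltr_pM2r ?invr_gt0 ?nR0// ltr_pM2l// ltr_int. Qed.

Lemma ler_vtx a b : (vtx a <= vtx b) = (a <= b).
Proof. by rewrite !leNgt ltr_vtx. Qed.

Lemma vtx_inj : injective vtx.
Proof. by move=> a b ab; apply/eqP; rewrite eq_le -!ler_vtx ab lexx. Qed.

Lemma bot_inj : injective bot. Proof. by move=> a b [] /vtx_inj. Qed.
Lemma top_inj : injective top. Proof. by move=> a b [] /addIr /vtx_inj. Qed.

Lemma bot_neq_top a b : bot a <> top b.
Proof. by case=> _ /eqP; rewrite -subr_eq0 -opprD oppr_eq0 -mulr2n mulrn_eq0 oner_eq0. Qed.

Lemma strip_bot a : strip R (bot a). Proof. by rewrite /strip /= lexx /=; lra. Qed.
Lemma strip_top a : strip R (top a). Proof. by rewrite /strip /= lexx andbT; lra. Qed.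

Lemma deck_even_bot k a : deck (2 * k) (bot a) = bot (a + k * n).
Proof. by rewrite /deck /bot sgn_even mul1r vtxD /= intrM. Qed.

Lemma deck_even_top k a : deck (2 * k) (top a) = top (a + k * n).
Proof. by rewrite /deck /top sgn_even mul1r vtxD /= intrM addrAC. Qed.

Lemma deck_odd_bot k a : deck (2 * k + 1) (bot a) = top (a + (k + 1) * n).
Proof. by rewrite /deck /bot /top sgn_odd mulrNN mul1r vtxD /= !intrD intrM; congr pair; ring. Qed.

Lemma deck_odd_top k a : deck (2 * k + 1) (top a) = bot (a + k * n).
Proof. by rewrite /deck /bot /top sgn_odd mulr1 vtxD /= !intrD intrM; congr pair; ring. Qed.

Lemma deck1_bot a : deck 1 (bot a) = top (a + n).
Proof. by have := deck_odd_bot 0 a; rewrite mulr0 !add0r mul1r. Qed.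

Lemma deck1_top a : deck 1 (top a) = bot a.
Proof. by have := deck_odd_top 0 a; rewrite mulr0 !add0r mul0r addr0. Qed.

Lemma deck_fix k p : deck k p = p -> k = 0.
Proof.
case: p => x y [+ _]; rewrite -[X in _ = X]addr0 => /addrI /eqP.
by rewrite intr_eq0 => /eqP.
Qed.

Lemma bdE (x : R) : bd x = pr (x, -1).
Proof. by rewrite /bd prE. Qed.

Lemma vertexE (k : nat) : vertex R n k = pr (bot k).
Proof. by rewrite /vertex bdE. Qed.

Lemma pr_botE a : exists2 k : nat, (k < n)%N & pr (bot a) = vertex R n k.
Proof.
pose r : int := (a %% n)%Z; pose q : int := (a %/ n)%Z.
have [r0 rn] : 0 <= r /\ r < n by rewrite /r; lia.
have aE : a = r + q * n by rewrite /r /q; lia.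
exists `|r|%N; first by lia.
rewrite aE -deck_even_bot pr_deck; last exact: strip_bot.
by rewrite vertexE; congr (pr (bot _)); lia.
Qed.

Lemma vertices_lift p : strip R p -> vertices R n (pr p) ->
  exists a, p = bot a \/ p = top a.
Proof.
move=> sp [k /= kn]; rewrite vertexE => /(pr_eqP (strip_bot _) sp)[l ->].
have [m [->|->]] := int_parity l.
  by exists (k%:Z + m * n); left; rewrite deck_even_bot.
by exists (k%:Z + (m + 1) * n); right; rewrite deck_odd_bot.
Qed.

Lemma vertices_bot a : vertices R n (pr (bot a)).
Proof. by have [k kn ->] := pr_botE a; exists k. Qed.

Lemma vertices_top a : vertices R n (pr (top a)).
Proof.
rewrite -(pr_deck 1 (strip_top a)) deck1_top.
exact: vertices_bot.
Qed.

Lemma boundaryP p : strip R p -> boundary R (pr p) <-> p.2 = -1 \/ p.2 = 1.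
Proof.
move=> sp; have sx (x : R) : strip R (x, -1) by rewrite /strip /= lexx /=; lra.
split.
  case=> x _; rewrite bdE => /(pr_eqP (sx x) sp)[k ->] /=.
  by case: (sgn_cases R k) => ->; [left|right]; rewrite ?mul1r ?mulN1r ?opprK.
case: p sp => x y sp /= [->|->]; first by exists x => //; rewrite bdE.
exists (x - 1) => //; rewrite bdE -(pr_deck 1 (sx _)) /deck /= sgn1.
by rewrite mulrNN mulr1 subrK.
Qed.

Lemma reverseK g : reverse (reverse g) = g.
Proof. by apply/funext => t; rewrite /reverse opprB addrCA subrr addr0. Qed.

Lemma joins_reverseE g p q : joins (reverse g) p q <-> joins g q p.
Proof. by split => [/joins_reverse|/joins_reverse//]; rewrite reverseK. Qed.

Lemma homotopicP g h p q : joins g p q ->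
  homotopic g h <-> joins h p q \/ joins h q p.
Proof. by move=> j; rewrite /homotopic !(homotopic_joins _ j) joins_reverseE. Qed.

Lemma within_reverse g : {within `[0, 1], continuous g} ->
  {within `[0, 1], continuous (reverse g)}.
Proof.
move=> /continuous_clamp_comp cg; have cg' : continuous (fun t : R => (g \o @clamp R) (1 - t)).
  move=> t; apply: (@continuous_comp _ _ _ (fun t : R => 1 - t) (g \o @clamp R)); last exact: cg.
  by apply: cvgB; [exact: cvg_cst|exact: cvg_id].
have : {within `[0, 1], continuous (fun t : R => (g \o @clamp R) (1 - t))}.
  exact: continuous_subspaceT.
apply: subspace_eq_continuous => t; rewrite inE /= in_itv /= => /andP[? ?].
have e : clamp (1 - t) = 1 - t by apply: clampE; apply/andP; lra.
exact: (congr1 g e).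
Qed.

Lemma simple_arc_reverse g : simple_arc n g -> simple_arc n (reverse g).
Proof.
case=> cg [g0 g1] gi ginj; split.
- exact: within_reverse.
- by rewrite /reverse subr0 subrr.
- by move=> t /andP[? ?]; apply: gi; apply/andP; lra.
- move=> s t s0 st t1 e.
  have [] : 1 - t = 0 /\ 1 - s = 1 by apply: ginj => //; lra.
  by move=> ? ?; split; lra.
Qed.

Lemma simple_arc_joins g : simple_arc n g ->
  exists a b, joins g (bot a) (top b) \/ joins g (bot a) (bot b).
Proof.
case=> cg [v0 v1] _ _.
have [k Ek] : exists a, pr (bot a) = g 0.
  by case: v0 => k /= kn <-; exists k => //; rewrite vertexE.
have [q jq] := joins_ex cg (strip_bot k) Ek.
have [_ sq _ gq] := joins_pr jq.
have [||b [bE|bE]] := @vertices_lift q => //; first by rewrite gq.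
  by exists k, b; right; rewrite -bE.
by exists k, b; left; rewrite -bE.
Qed.

(** Translates have the same projection, and a simple arc takes a value twice only
    at its two ends. *)
Lemma simple_lift_meet g L k s t : simple_arc n g -> lifts L g -> k != 0 ->
  0 <= s <= 1 -> 0 <= t <= 1 -> deck k (L s) = L t ->
  (s = 0 /\ t = 1) \/ (s = 1 /\ t = 0).
Proof.
move=> [_ _ _ ginj] [_ sL Lg] k0 s1 t1 e.
have gst : g s = g t by rewrite -!Lg// -e pr_deck//; exact: sL.
case: (ltgtP s t) => st.
- by left; apply: ginj => //; case/andP: s1 => //; case/andP: t1.
- by right; apply/and_comm/ginj => //; case/andP: s1 => //; case/andP: t1.
- by move: e; rewrite st => /deck_fix /eqP; rewrite (negbTE k0).
Qed.

Lemma not_disjointP L M : ~ disjoint_curves L M ->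
  exists s t, [/\ 0 <= s <= 1, 0 <= t <= 1 & L s = M t].
Proof.
move=> h; apply: contrapT => h'; apply: h => s t s1 t1; apply/eqP => e.
by apply: h'; exists s, t.
Qed.

(** For b < a the lift and its image under the glide reflection would cross. *)
Lemma simple_top_le g a b : simple_arc n g -> joins g (bot a) (top b) -> a <= b.
Proof.
move=> sg [L [Lg L0 L1]]; rewrite leNgt; apply/negP => ba.
pose M t := deck 1 (L (1 - t)).
have [cM sM _] := lifts_deck 1 (lifts_reverse Lg); have [cL sL _] := Lg.
have M0 : M 0 = bot b by rewrite /M subr0 L1 deck1_top.
have M1 : M 1 = top (a + n) by rewrite /M subrr L0 deck1_bot.
have : ~ disjoint_curves M L.
  apply: (swapped_crosscuts_meet cM cL sM sL M0 M1 L0 L1); first by rewrite ltr_vtx.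
  by rewrite ltrD2r ltr_vtx; lia.
move=> /not_disjointP[s [t [s1 t1 e]]].
have s1' : 0 <= 1 - s <= 1 by move: s1 => /andP[? ?]; apply/andP; lra.
have [[es et]|[es et]] := simple_lift_meet (k := 1) sg Lg isT s1' t1 e.
  by move: e; rewrite /M es et L0 L1 deck1_bot => /top_inj; lia.
by move: e; rewrite /M es et L0 L1 deck1_top => /bot_inj; lia.
Qed.

Lemma joins_flip g a b : joins g (bot a) (top b) <-> joins g (top (a + n)) (bot b).
Proof.
split => [/(joins_deck 1)|/(joins_deck (- 1))]; first by rewrite deck1_bot deck1_top.
by rewrite -deck1_bot -(deck1_top b) !deckK.
Qed.

Lemma simple_top g a b : simple_arc n g -> joins g (bot a) (top b) -> a <= b <= a + n.
Proof.
move=> sg j; rewrite (simple_top_le sg j)/=.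
apply: (@simple_top_le (reverse g)); first exact: simple_arc_reverse.
by apply/joins_reverseE/joins_flip.
Qed.

(** For b > a + n the end points of the lift and of its translate by the period 2
    of the boundary would be linked. *)
Lemma simple_bot_le g a b : simple_arc n g -> joins g (bot a) (bot b) -> b <= a + n.
Proof.
move=> sg [L [Lg L0 L1]]; rewrite leNgt; apply/negP => ba.
pose M t := deck 2 (L t).
have [cM sM _] := lifts_deck 2 Lg; have [cL sL _] := Lg.
have d2 c : deck 2 (bot c) = bot (c + n) by have := deck_even_bot 1 c; rewrite mulr1 mul1r.
have M0 : M 0 = bot (a + n) by rewrite /M L0 d2.
have M1 : M 1 = bot (b + n) by rewrite /M L1 d2.
have : ~ disjoint_curves M L.
  move=> h; have {}h : disjoint_curves L M by move=> s t s1 t1; rewrite eq_sym h.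
  by apply: (linked_arcs_meet cL cM sL sM L0 L1 M0 M1) h; rewrite ltr_vtx; lia.
move=> /not_disjointP[s [t [s1 t1 e]]].
have [[es et]|[es et]] := simple_lift_meet (k := 2) sg Lg isT s1 t1 e.
  by move: e; rewrite /M es et L0 L1 d2 => /bot_inj; lia.
by move: e; rewrite /M es et L0 L1 d2 => /bot_inj; lia.
Qed.

Lemma simple_bot g a b : simple_arc n g -> joins g (bot a) (bot b) ->
  b <= a + n /\ a <= b + n.
Proof.
move=> sg j; split; first exact: simple_bot_le sg j.
apply: (@simple_bot_le (reverse g)); first exact: simple_arc_reverse.
exact/joins_reverseE.
Qed.

End Arcs.

(** * Classes of core arcs *)
Section Segments.
Variables (R : realType) (n : nat).
Hypothesis n0 : (0 < n)%N.
Implicit Types (p q : R * R) (a b c d k : int) (g h : R -> moebius R) (L M : R -> R * R).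

Local Notation vtx := (vtx R n).
Local Notation bot := (bot R n).
Local Notation top := (top R n).

Definition core_class a b : set (R -> moebius R) :=
  [set h | simple_arc n h /\ (joins h (bot a) (top b) \/ joins h (top b) (bot a))].

Definition chord_pt a b (t : R) : R * R := ((1 - t) * vtx a + t * (vtx b - 1), -1 + 2 * t).
Definition chord a b (t : R) := pr (chord_pt a b t).

(** Lifts with end points indexed by (a, b) and (c, d) need not cross when the
    pairs are comparable in the product order. *)
Definition unlinked a b c d := (a <= c /\ b <= d) \/ (c <= a /\ d <= b).

(** The pair (c, d) is replaced by all its translates under the group generated
    by (c, d) -> (d, c + n), the action of the glide reflection. *)
Definition noncrossing a b c d :=
  forall k, unlinked a b (c + k * n) (d + k * n) /\ unlinked a b (d + k * n) (c + (k + 1) * n).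
Definition same_orbit a b c d :=
  exists k, (c = a + k * n /\ d = b + k * n) \/ (c = b + k * n /\ d = a + (k + 1) * n).

Lemma arc_class_core_class g a b : joins g (bot a) (top b) -> arc_class n g = core_class a b.
Proof.
move=> j; apply/seteqP; split => h [sh]; first by move=> /(homotopicP _ j).
by move=> jh; split => //; apply/homotopicP; eassumption.
Qed.

Lemma core_class_flip a b : core_class a b = core_class b (a + n).
Proof.
have e g : joins g (top b) (bot a) <-> joins g (bot b) (top (a + n)).
  by rewrite -joins_reverseE joins_flip// joins_reverseE.
apply/seteqP; split => h [sh] jh; split => //.
  by case: jh => [/(joins_flip n0)|/e] jh; [right|left].
by case: jh => [/e|/(joins_flip n0)] jh; [right|left].
Qed.

Lemma core_class_shift a b k : core_class (a + k * n) (b + k * n) = core_class a b.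
Proof.
have e g p q : joins g (deck (2 * k) p) (deck (2 * k) q) <-> joins g p q.
  by split => [/(joins_deck (- (2 * k)))|/(joins_deck (2 * k))//]; rewrite !deckK.
rewrite /core_class -!deck_even_bot// -!deck_even_top//.
by apply/seteqP; split => h [sh jh]; split => //; move: jh; rewrite !e.
Qed.

Lemma core_class_orbit a b c d : same_orbit a b c d -> core_class a b = core_class c d.
Proof.
case=> k [[-> ->]|[-> ->]]; first by rewrite core_class_shift.
by rewrite mulrDl mul1r addrA addrAC core_class_shift -core_class_flip.
Qed.

Lemma joins_same_orbit g a b c d : joins g (bot a) (top b) ->
  joins g (bot c) (top d) \/ joins g (top d) (bot c) -> same_orbit a b c d.
Proof.
move=> j [] j'; have [k [e1 e2]] := joins_unique j j'.
- have [m [km|km]] := int_parity k; rewrite km in e1 e2.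
    move: e1 e2; rewrite deck_even_bot// deck_even_top// => /(bot_inj n0) -> /(top_inj n0) ->.
    by exists m; left.
  by move: e1; rewrite deck_odd_bot// => /bot_neq_top.
- have [m [km|km]] := int_parity k; rewrite km in e1 e2.
    by move: e1; rewrite deck_even_bot// => /esym/bot_neq_top.
  move: e1 e2; rewrite deck_odd_bot// deck_odd_top// => /(top_inj n0) -> /(bot_inj n0) ->.
  by exists m; right.
Qed.

Lemma joins_bot_top g a b c d : joins g (bot a) (top b) -> ~ joins g (bot c) (bot d).
Proof.
move=> j j'; have [k [e1 e2]] := joins_unique j j'.
have [m [km|km]] := int_parity k; rewrite km in e1 e2.
  by move: e2; rewrite deck_even_top// => /bot_neq_top.
by move: e1; rewrite deck_odd_bot// => /bot_neq_top.
Qed.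

Lemma chord_pt0 a b : chord_pt a b 0 = bot a.
Proof. by rewrite /chord_pt /bot; congr pair; ring. Qed.

Lemma chord_pt1 a b : chord_pt a b 1 = top b.
Proof. by rewrite /chord_pt /top; congr pair; ring. Qed.

Lemma chord_pt_strip a b : in_strip (chord_pt a b).
Proof. by move=> t /andP[? ?]; rewrite /strip /=; apply/andP; lra. Qed.

Lemma chord_pt_continuous a b : continuous (chord_pt a b).
Proof.
apply: continuous_pair => t; apply: cvgD; try exact: cvg_cst;
  apply: cvgM; try exact: cvg_cst; try exact: cvg_id.
by apply: cvgB; [exact: cvg_cst|exact: cvg_id].
Qed.

Lemma chord_joins a b : joins (chord a b) (bot a) (top b).
Proof.
exists (chord_pt a b); rewrite chord_pt0 chord_pt1; split => //; split => //.
  exact: chord_pt_continuous.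
exact: chord_pt_strip.
Qed.

Lemma deck_even_chord k a b t : deck (2 * k) (chord_pt a b t) = chord_pt (a + k * n) (b + k * n) t.
Proof. by rewrite /deck /chord_pt sgn_even mul1r !vtxD// intrM /=; congr pair; ring. Qed.

Lemma deck_odd_chord k a b t :
  deck (2 * k + 1) (chord_pt a b t) = chord_pt (b + k * n) (a + (k + 1) * n) (1 - t).
Proof. by rewrite /deck /chord_pt sgn_odd !vtxD// !intrD intrM /=; congr pair; ring. Qed.

(** Both chords have height -1 + 2 t at time t, and their horizontal distance is
    a convex combination of the distances at the two ends, which have the same
    sign. *)
Lemma chords_meet a b c d s t : 0 <= s <= 1 ->
  unlinked a b c d -> (a, b) <> (c, d) -> chord_pt a b s = chord_pt c d t ->
  s = t /\ (s = 0 \/ s = 1).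
Proof.
move=> /andP[s0 s1] abcd ne [e1 e2].
have st : s = t by lra.
split => //; rewrite -{t}st in e1 e2.
case: (eqVneq s 0) => [|s0']; first by left.
case: (eqVneq s 1) => [|s1']; first by right.
have {}s0 : 0 < s by rewrite lt_neqAle eq_sym s0'.
have {}s1 : 0 < 1 - s by rewrite subr_gt0 lt_neqAle s1'.
have e : (1 - s) * (vtx a - vtx c) + s * (vtx b - vtx d) = 0 by rewrite !mulrBr; lra.
exfalso; apply: ne; case: abcd; rewrite -!(ler_vtx R n0) -![_ <= vtx _]subr_ge0 => -[h1 h2].
  have := mulr_ge0 (ltW s1) h1; have := mulr_ge0 (ltW s0) h2 => k1 k2.
  have [/eqP + /eqP] : (1 - s) * (vtx c - vtx a) = 0 /\ s * (vtx d - vtx b) = 0.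
    by rewrite !mulrBr in e k1 k2 *; lra.
  by rewrite !mulf_eq0 (gt_eqF s1) (gt_eqF s0) /= !subr_eq0 => /eqP/(vtx_inj n0) -> /eqP/(vtx_inj n0) ->.
have := mulr_ge0 (ltW s1) h1; have := mulr_ge0 (ltW s0) h2 => k1 k2.
have [/eqP + /eqP] : (1 - s) * (vtx a - vtx c) = 0 /\ s * (vtx b - vtx d) = 0.
  by rewrite !mulrBr in e k1 k2 *; lra.
by rewrite !mulf_eq0 (gt_eqF s1) (gt_eqF s0) /= !subr_eq0 => /eqP/(vtx_inj n0) -> /eqP/(vtx_inj n0) ->.
Qed.

(** Bounds that make the product [k * n] tractable for linear arithmetic. *)
Lemma mulz_cases k : (0 <= k /\ 0 <= k * n) \/ (k <= -1 /\ k * n <= - n%:Z).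
Proof.
have [k0|k0] := lerP 0 k; first by left; rewrite mulr_ge0.
have k1 : k <= -1 by lia.
by right; split => //; rewrite -mulN1r ler_wpM2r.
Qed.

Lemma chord_simple a b : a <= b <= a + n -> simple_arc n (chord a b).
Proof.
move=> /andP[ab ban]; split.
- apply: continuous_subspaceT; apply: pr_comp_continuous; exact: chord_pt_continuous.
- by rewrite /chord chord_pt0 chord_pt1; split; [exact: vertices_bot|exact: vertices_top].
- move=> t /andP[t0 t1]; rewrite boundaryP; first by rewrite /=; lra.
  by apply: chord_pt_strip; rewrite !ltW.
- move=> s t s0 st t1; have s1 : 0 <= s <= 1 by apply/andP; lra.
  have t1' : 0 <= t <= 1 by apply/andP; lra.
  move=> /(pr_eqP (chord_pt_strip a b s1) (chord_pt_strip a b t1'))[k].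
  have [m [->|->]] := int_parity k.
    by rewrite deck_even_chord => -[_ e]; lra.
  rewrite deck_odd_chord => e.
  have [||es [et|et]] := chords_meet t1' _ _ e; try by (split; lra).
    by rewrite /unlinked mulrDl mul1r; case: (mulz_cases m); lia.
  by rewrite mulrDl mul1r => -[]; case: (mulz_cases m); lia.
Qed.

Definition meet_ends g h := forall s t, 0 <= s <= 1 -> 0 <= t <= 1 -> g s = h t ->
      (s = 0 \/ s = 1) /\ (t = 0 \/ t = 1).

Lemma meet_ends_sym g h : meet_ends g h -> meet_ends h g.
Proof. by move=> m s t s1 t1 /esym/(m _ _ t1 s1)[]. Qed.

Lemma meet_ends_rev g h : meet_ends g h -> meet_ends (reverse g) h.
Proof.
move=> m s t s1 t1 e.
have s1' : 0 <= 1 - s <= 1 by move: s1 => /andP[? ?]; apply/andP; lra.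
by have [[] ? ?] := m _ _ s1' t1 e; split => //; [right|left]; lra.
Qed.

(** If b were greater than d, the lifts would cross, and by hypothesis they can
    meet only at vertices; but there they have different end points. *)
Lemma joins_monotone g h a b c d : joins g (bot a) (top b) -> joins h (bot c) (top d) ->
  meet_ends g h -> a < c -> b <= d.
Proof.
move=> [L [[cL sL Lg] L0 L1]] [M [[cM sM Mh] M0 M1]] m ac.
rewrite leNgt; apply/negP => db.
have : ~ disjoint_curves L M.
  apply: (swapped_crosscuts_meet cL cM sL sM L0 L1 M0 M1); rewrite ?ltrD2r ltr_vtx//.
move=> /not_disjointP[s [t [s1 t1 e]]].
have [] : (s = 0 \/ s = 1) /\ (t = 0 \/ t = 1) by apply: m => //; rewrite -Lg// -Mh// e.
move=> [es|es] [et|et]; move: e; rewrite es et ?L0 ?L1 ?M0 ?M1.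
- by move=> /(bot_inj n0); lia.
- by move=> /bot_neq_top.
- by move=> /esym /bot_neq_top.
- by move=> /(top_inj n0); lia.
Qed.

Lemma core_class_oriented a b h : core_class a b h ->
  exists2 h', h' = h \/ h' = reverse h & joins h' (bot a) (top b).
Proof.
case=> _ [j|j]; first by exists h => //; left.
by exists (reverse h); [right|exact: joins_reverse].
Qed.

Lemma disjoint_unlinked a b c d : disjoint_classes (core_class a b) (core_class c d) -> unlinked a b c d.
Proof.
move=> [g [h [/core_class_oriented[g' gg' jg] /core_class_oriented[h' hh' jh] m]]].
have {}m : meet_ends g' h'.
  have m' : meet_ends g' h by case: gg' => ->; [|apply: meet_ends_rev].
  by case: hh' => ->; [|apply/meet_ends_sym/meet_ends_rev/meet_ends_sym].
have h1 := joins_monotone jg jh m; have h2 := joins_monotone jh jg (meet_ends_sym m).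
by rewrite /unlinked; lia.
Qed.

Lemma disjoint_noncrossing a b c d : disjoint_classes (core_class a b) (core_class c d) -> noncrossing a b c d.
Proof.
move=> h k; split; apply: disjoint_unlinked; first by rewrite core_class_shift.
by rewrite -(@core_class_orbit c d (d + k * n) (c + (k + 1) * n))//; exists k; right.
Qed.

(** The straight chords are disjoint representatives. *)
Lemma noncrossing_disjoint a b c d : a <= b <= a + n -> c <= d <= c + n ->
  noncrossing a b c d -> ~ same_orbit a b c d -> disjoint_classes (core_class a b) (core_class c d).
Proof.
move=> ab cd co so; exists (chord a b), (chord c d); split.
- by split; [exact: chord_simple|left; exact: chord_joins].
- by split; [exact: chord_simple|left; exact: chord_joins].
move=> s t s1 t1 /esym/(pr_eqP (chord_pt_strip c d t1) (chord_pt_strip a b s1))[k].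
have [m [->|->]] := int_parity k; have [c1 c2] := co m.
  rewrite deck_even_chord => /(chords_meet s1 c1)[|<-]; last by [].
  by move=> [ae be]; apply: so; exists (- m); left; lia.
rewrite deck_odd_chord => /(chords_meet s1 c2)[|e].
  by move=> [ae be]; apply: so; exists (- (m + 1)); right; split; [nia|nia].
by case=> es; split; (try by [left|right]); [right|left]; lra.
Qed.

Lemma core_class_eq_orbit a b c d : a <= b <= a + n -> core_class a b = core_class c d -> same_orbit a b c d.
Proof.
move=> ab e; have : core_class a b (chord a b) by split; [exact: chord_simple|left; exact: chord_joins].
by rewrite e => -[_]; apply: joins_same_orbit; exact: chord_joins.
Qed.

Lemma cst_joins (k : nat) : joins (cst (vertex R n k)) (bot k) (bot k).
Proof.
exists (cst (bot k)); split => //; split => //; first exact: cst_continuous.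
  by move=> t _; exact: strip_bot.
by move=> t _; rewrite vertexE.
Qed.

Lemma edge_joins (k : nat) : joins (edge n k) (bot k) (bot (k%:Z + 1)).
Proof.
exists (fun t => (2 * (k%:R + t) / n%:R, -1)); split.
- split.
  + apply: continuous_pair; last exact: cst_continuous.
    move=> t; apply: cvgM; last exact: cvg_cst.
    by apply: cvgM; [exact: cvg_cst|apply: cvgD; [exact: cvg_cst|exact: cvg_id]].
  + by move=> t _; exact: (strip_bot R n 0).
  + by move=> t _; rewrite /edge bdE.
- by rewrite addr0.
- by rewrite /bot /vtx intrD.
Qed.

(** Such an arc is not trivial because trivial arcs have both end points on the
    same side of the strip, and the non-orientable part of a decomposition cannot
    exist by [crosscut_orientable]. *)
Lemma core_class_c_class a b : a <= b <= a + n -> c_class n (core_class a b).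
Proof.
move=> ab; have jab := chord_joins a b; split.
  exists (chord a b); split; [exact: chord_simple| |by rewrite (arc_class_core_class jab)].
  case=> k _ [] /(homotopicP _ jab).
    case=> j; first exact: joins_bot_top j (cst_joins k).
    exact: joins_bot_top (joins_reverse j) (joins_reverse (cst_joins k)).
  case=> j; first exact: joins_bot_top j (edge_joins k).
  exact: joins_bot_top (joins_reverse j) (joins_reverse (edge_joins k)).
case=> g /core_class_oriented[g' gg' jg] [U [W [UW _ _ [oW _ _] [_ nW]]]].
apply/nW/(crosscut_orientable jg) => // t t1 Wg.
have : (U `|` W) (g' t) by right.
rewrite -UW; apply; case: gg' => ->; first by exists t => //; rewrite /= in_itv.
exists (1 - t) => //; rewrite /= in_itv /=; move: t1 => /andP[? ?]; apply/andP; lra.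
Qed.

End Segments.

(** * Arcs that cut off a disc *)
Section Tools.
Variable R : realType.
Implicit Types (p q : R * R).

Lemma path_in_connected (U : set (moebius R)) p :
  (forall m, U m -> exists2 q, pr q = m & path_in U p q) -> connected U.
Proof.
move=> h.
pose P (B : set (moebius R)) := [/\ connected B, B `<=` U & B (pr p)].
have -> : U = \bigcup_(B in P) B.
  apply/seteqP; split => [m Um|m [B [_ BU _]]]; last exact: BU.
  have [q qm [c [cc c0 c1 cU]]] := h m Um.
  exists ((fun t => pr (c t)) @` `[0, 1]).
    split.
    - apply: connected_continuous_connected.
        by apply/connected_intervalP; exact: interval_is_interval.
      by apply: continuous_subspaceT; exact: pr_comp_continuous.
    - by move=> _ [t /= t01 <-]; have [] := cU t; rewrite ?in_itv in t01 *.
    - by exists 0; rewrite ?c0//= in_itv /= lexx ler01.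
  by exists 1; rewrite ?c1//= in_itv /= lexx ler01.
apply: bigcup_connected => [|B [cB _ _]]; last exact: cB.
exists (pr p) => B [_ _ Bp]; exact: Bp.
Qed.

(** An orientation would be constant along the core y = 0, whose end points (0, 0)
    and (1, 0) are exchanged with a change of sign. *)
Lemma core_not_orientable (W : set (moebius R)) :
  (forall x : R, W (pr (x, 0))) -> ~ orientable W.
Proof.
move=> core [e [/subspace_continuousP ce eN]].
have sx (x : R) : strip R (x, 0) by rewrite /strip /=; apply/andP; lra.
pose c (x : R) : strip R := exist _ (x, 0) (mem_set (sx x)).
have cc : continuous c.
  apply: continuous_comp_initial.
  have -> : set_val \o c = (fun x => (x, 0)) by apply/funext.
  by apply: continuous_pair => x; [exact: cvg_id|exact: cvg_cst].
have Wc x : W (to_moebius (c x)) by rewrite prE; exact: core.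
pose f (x : R) : R := if e (c x) then 1 else 0.
have cf : continuous f.
  move=> x; apply: cvg_near_cst.
  have h := ce _ (Wc x) [set e (c x)] (discrete_set1 _).
  have := cc x _ h; rewrite /prop_near1 /nbhs /=.
  apply: (@filterS _ (nbhs x) _) => y /= hy.
  by have eyx : e (c y) = e (c x) := hy (Wc y); rewrite /f eyx.
have ne : e (c 1) = ~~ e (c 0).
  by apply: eN => //=; rewrite ?add0r ?oppr0.
have [||z _] := @IVT R f 0 1 (1 / 2) ler01.
- exact: continuous_subspaceT.
- rewrite /f ne; case: (e (c 0)) => /=; rewrite ge_min le_max; apply/andP; split;
   apply/orP; solve [left; lra|right; lra].
by rewrite /f; case: (e (c z)); lra.
Qed.

(** Off the core, the sign of y is an orientation. *)
Lemma offcore_orientable (U : set (moebius R)) :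
  (forall p, strip R p -> U (pr p) -> p.2 != 0) -> orientable U.
Proof.
move=> Uy; exists (fun x : strip R => (val x).2 < 0); split.
- apply/subspace_continuousP => x Ux; apply: cvg_near_cst.
  have sx : strip R (val x) by case: x {Ux} => p hp; exact: set_mem hp.
  have x2 : (val x).2 != 0 by apply: Uy => //; rewrite -prE.
  have c2 : continuous (fun x : strip R => (val x).2).
    by apply: continuous_snd; exact: initial_continuous.
  have h : \forall y \near x, ((val y).2 < 0) = ((val x).2 < 0).
    case: (ltgtP (val x).2 0) x2 => // x2 _.
      by have := c2 x _ (lt_nbhsl x2); apply: (@filterS _ (nbhs x) _) => y /=.
    have := c2 x _ (lt_nbhsr x2); apply: (@filterS _ (nbhs x) _) => y /= y0.
    by apply/negbTE; rewrite -leNgt ltW.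
  rewrite /prop_near1 /nbhs /= /within /=; apply: (@filterS _ (nbhs x) _) h => y hy _.
  exact: hy.
- move=> p q; rewrite prE => Up _ ->; rewrite oppr_lt0 -leNgt le_eqVlt.
  suff -> : (0 == (val p).2) = false by [].
  rewrite eq_sym; apply/negbTE/Uy => //.
  by case: p {Up} => p hp; exact: set_mem hp.
Qed.

End Tools.

Section Bow.
Variables (R : realType) (m w : R).
Hypotheses (w0 : 0 < w) (w1 : w <= 1).
Implicit Types (p q : R * R) (k : int).

Lemma combE (t x y x' y' : R) :
  (1 - t) *: (x, y) + t *: (x', y') = ((1 - t) * x + t * x', (1 - t) * y + t * y') :> R * R.
Proof. by []. Qed.

(** The arc between the vertices at m - w and m + w is the graph of
    - 1 / (1 + rise x): it stays below the core, and [rise] is positive exactly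
    between the end points, modulo the period 2. *)
Definition rise (x : R) := cos (pi * (x - m)) - cos (pi * w).

Lemma rise_cos x : rise x = cos (pi * `|x - m|) - cos (pi * w).
Proof.
rewrite /rise; congr (_ - _).
by rewrite -cos_norm normrM gtr0_norm// pi_gt0.
Qed.

Let piP (y : R) : 0 <= y <= 1 -> pi * y \in `[0, pi]%R.
Proof.
move=> /andP[y0 y1]; rewrite in_itv /= mulr_ge0 ?pi_ge0//=.
by rewrite ler_piMr ?pi_ge0.
Qed.

Lemma rise_gt0 x : `|x - m| <= 1 -> (0 < rise x) = (`|x - m| < w).
Proof.
move=> x1; rewrite rise_cos subr_gt0 ltr_cos ?piP ?normr_ge0//; last by rewrite ltW.
by rewrite ltr_pM2l ?pi_gt0.
Qed.

Lemma rise_ge0 x : `|x - m| <= 1 -> (0 <= rise x) = (`|x - m| <= w).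
Proof.
move=> x1; rewrite rise_cos subr_ge0 !leNgt ltr_cos ?piP ?normr_ge0//; last by rewrite ltW.
by rewrite ltr_pM2l ?pi_gt0.
Qed.

(** A function on the strip that is invariant under deck transformations, and
    whose zero set is the union of the lifts of the arc: on the lower half it is
    1 - s (1 + rise x), where s = - y.  It is 1 on the core. *)
Definition height p : R :=
  1 - `|p.2| + (p.2 * cos (pi * (p.1 - m)) + `|p.2| * cos (pi * w)).

Lemma height_deck k p : height (deck k p) = height p.
Proof.
rewrite /height /= normrM.
have -> : `|sgn R k| = 1 by case: (sgn_cases R k) => ->; rewrite ?normrN normr1.
have -> : pi * (p.1 + k%:~R - m) = pi * (p.1 - m) + pi * k%:~R by ring.
rewrite cosD cos_sgn sin_sgn mulr0 subr0 !mul1r.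
have e (x y c : R) : x * y * (c * x) = x * x * (y * c) by ring.
by rewrite e sgn_sqr mul1r.
Qed.

Lemma height_lower x s : 0 <= s -> height (x, - s) = 1 - s * (1 + rise x).
Proof. by move=> s0; rewrite /height /= normrN ger0_norm// /rise; ring. Qed.

Lemma height_continuous : continuous height.
Proof.
have c2 : continuous (fun p : R * R => `|p.2|).
  by move=> p; apply: (@continuous_comp _ _ _ snd (fun y : R => `|y|)); [exact: cvg_snd|exact: norm_continuous].
apply: continuous_addf.
  by move=> p; apply: cvgB; [exact: cvg_cst|exact: c2].
apply: continuous_addf; apply: continuous_mulf.
- by move=> p; exact: cvg_snd.
- apply: continuous_cosf; apply: continuous_scalef => p.
  by apply: cvgB; [exact: cvg_fst|exact: cvg_cst].
- exact: c2.
- exact: cst_continuous.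
Qed.

(** A fundamental domain: the lower half over one period, centred at [m]. *)
Lemma lower_lift (z : moebius R) : exists x s,
  [/\ pr (x, - s) = z, 0 <= s <= 1 & `|x - m| <= 1].
Proof.
have [p [sp pz p2]] : exists p, [/\ strip R p, pr p = z & p.2 <= 0].
  have [p sp pz] := pr_surj z; have [p2|p2] := leP p.2 0; first by exists p.
  exists (deck 1 p); rewrite pr_deck//; split => //; first exact: strip_deck.
  by rewrite /= sgn1 mulN1r oppr_le0 ltW.
pose j := Num.floor ((p.1 - m + 1) / 2).
have := floor_itv ((p.1 - m + 1) / 2); rewrite -/j => /andP[j1 j2].
have sp' : strip R (deck (2 * - j) p) by exact: strip_deck.
exists (p.1 - 2 * j%:~R), (- p.2); rewrite opprK; split.
- rewrite -pz -(pr_deck (2 * - j) sp); congr pr.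
  by rewrite /deck sgn_even mul1r mulrN mulrNz intrM.
- by move: sp => /andP[? ?]; apply/andP; lra.
- by rewrite ler_norml; move: j2; rewrite intrD => ?; apply/andP; lra.
Qed.

Lemma rise_mid : 0 < rise m.
Proof. by rewrite rise_gt0 subrr normr0. Qed.

Definition bow_pt (t : R) : R * R :=
  (m - w + 2 * w * t, - (1 + rise (m - w + 2 * w * t))^-1).

Lemma bow_dist (t : R) : 0 <= t <= 1 -> `|m - w + 2 * w * t - m| <= w.
Proof.
move=> /andP[t0 t1].
have -> : m - w + 2 * w * t - m = w * (2 * t - 1) by ring.
rewrite normrM gtr0_norm// ler_piMr ?(ltW w0)// ler_norml; apply/andP; lra.
Qed.

Lemma bow_rise (t : R) : 0 <= t <= 1 -> 0 <= rise (m - w + 2 * w * t).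
Proof.
move=> t1; have h := bow_dist t1; rewrite rise_ge0//.
exact: le_trans h w1.
Qed.

Lemma bow_rise_gt (t : R) : 0 < t < 1 -> 0 < rise (m - w + 2 * w * t).
Proof.
move=> /andP[t0 t1]; have t01 : 0 <= t <= 1 by rewrite !ltW.
rewrite rise_gt0; last exact: le_trans (bow_dist t01) w1.
have -> : m - w + 2 * w * t - m = w * (2 * t - 1) by ring.
rewrite normrM gtr0_norm// gtr_pMr// ltr_norml; apply/andP; lra.
Qed.

Definition bow (t : R) : moebius R := pr (bow_pt (clamp t)).

Lemma bow_continuous : continuous (fun t => bow_pt (clamp t)).
Proof.
have cx : continuous (fun t : R => m - w + 2 * w * clamp t).
  apply: continuous_addf; first exact: cst_continuous.
  by apply: continuous_scalef; exact: continuous_clamp.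
apply: continuous_pair => // t; apply: cvgN; apply: cvgV.
  by rewrite gt_eqF// ltr_wpDr// bow_rise// clampP.
apply: cvgD; first exact: cvg_cst.
apply: cvgB; last exact: cvg_cst.
apply: (@continuous_cosf R R (fun t => pi * (m - w + 2 * w * clamp t - m)) _ t).
apply: continuous_scalef => {}t; apply: cvgB; [exact: cx|exact: cvg_cst].
Qed.

Lemma bow_y t : 0 <= t <= 1 -> -1 <= (bow_pt t).2 < 0.
Proof.
move=> /bow_rise; rewrite /bow_pt /=; move: (rise _) => r r0.
by rewrite oppr_lt0 invr_gt0 lerN2 invf_le1 ?ltr_wpDr// lerDl r0.
Qed.

Lemma bow_strip t : 0 <= t <= 1 -> strip R (bow_pt t).
Proof. by move=> /bow_y/andP[? ?]; apply/andP; split => //; lra. Qed.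

Lemma height_bow t : 0 <= t <= 1 -> height (bow_pt t) = 0.
Proof.
move=> /bow_rise r0; rewrite height_lower; last by rewrite invr_ge0 addr_ge0.
by rewrite mulVf ?subrr// gt_eqF// ltr_wpDr.
Qed.

Lemma bow_lifts : lifts (fun t => bow_pt (clamp t)) bow.
Proof.
split => //; first exact: bow_continuous.
by move=> t _; apply: bow_strip; exact: clampP.
Qed.

Lemma rise_end (e : R) : `|e| = 1 -> rise (m + e * w) = 0.
Proof.
move=> e1; rewrite rise_cos (_ : m + e * w - m = e * w); last by ring.
by rewrite normrM e1 mul1r gtr0_norm// subrr.
Qed.

Lemma bow_joins : joins bow (m - w, -1) (m + w, -1).
Proof.
exists (fun t => bow_pt (clamp t)); split; first exact: bow_lifts.
  rewrite clampE ?unit_itv0// /bow_pt mulr0 addr0 -[- w]mulN1r rise_end ?normrN1//.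
  by rewrite addr0 invr1.
rewrite clampE ?unit_itv1// /bow_pt mulr1.
have -> : m - w + 2 * w = m + 1 * w by ring.
by rewrite rise_end ?normr1// addr0 invr1 mul1r.
Qed.

(** Translates that preserve the sign of y move the arc by at least 2, and the arc has
    width 2 w <= 2. *)
Lemma bow_inj s t : 0 <= s -> s < t -> t <= 1 -> bow s = bow t -> s = 0 /\ t = 1.
Proof.
move=> s0 st t1; have s1 : 0 <= s <= 1 by apply/andP; lra.
have t1' : 0 <= t <= 1 by apply/andP; lra.
rewrite /bow !clampE// => /(pr_eqP (bow_strip s1) (bow_strip t1'))[k e].
have /andP[_ ys] := bow_y s1; have /andP[_ yt] := bow_y t1'.
have [j [kj|kj]] := int_parity k; last first.
  have : (bow_pt t).2 = - (bow_pt s).2 by rewrite e kj /= sgn_odd mulN1r.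
  by move: ys yt; lra.
have : (bow_pt t).1 = (bow_pt s).1 + (2 * j)%:~R by rewrite e kj.
rewrite /= intrM => ej.
have ej' : w * (t - s) = j%:~R by lra.
have j0 : 0 < j by rewrite -(ltr_int R) -ej' mulr_gt0// subr_gt0.
have : (1 : R) <= j%:~R by rewrite (ler_int R 1).
rewrite -ej' => h.
have : w * (t - s) <= t - s by rewrite ler_piMl// subr_ge0 ltW.
by move=> ?; split; lra.
Qed.

(** The two parts are given by the sign of [height].  On a vertical half line
    from the core, [height] is affine with value 1 at the core.  So the positive part
    contracts vertically to the core, and is not orientable; the negative part
    contracts vertically to the boundary interval below the arc, and avoids the core. *)
Lemma bow_decomposes : decomposes bow.
Proof.
have [F cF FE] := moebius_fun height_continuous height_deck.
have slower x s : 0 <= s <= 1 -> strip R (x, - s).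
  by move=> /andP[? ?]; apply/andP; rewrite /=; lra.
have Flow x s : 0 <= s <= 1 -> F (pr (x, - s)) = 1 - s * (1 + rise x).
  move=> s1; rewrite FE; last exact: slower.
  by rewrite height_lower//; case/andP: s1.
have F0 x : F (pr (x, 0)) = 1.
  by rewrite -[0]oppr0 Flow ?unit_itv0// mul0r subr0.
exists [set z | F z < 0], [set z | 0 < F z]; split.
- apply/seteqP; split => z.
    move=> h; have : F z != 0.
      apply/eqP => Fz; apply: h; have [x [s [xz s1 x1]]] := lower_lift z.
      move: Fz; rewrite -xz Flow// => /eqP; rewrite subr_eq0 => /eqP Fx.
      have [s0 s1'] := andP s1.
      have r0 : 0 <= rise x.
        rewrite leNgt; apply/negP => rn.
        have : s * (1 + rise x) <= s + s * rise x by rewrite mulrDr mulr1.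
        have : s * rise x <= 0 by rewrite mulr_ge0_le0// ltW.
        have sp : 0 < s.
          by rewrite lt_neqAle s0 andbT; apply/eqP => s00; move: Fx; rewrite -s00 mul0r; apply/eqP; rewrite oner_eq0.
        have : s * rise x < 0 by rewrite pmulr_rlt0.
        lra.
      have xw : `|x - m| <= w by rewrite -rise_ge0.
      pose t := (x - m + w) / (2 * w).
      have t01 : 0 <= t <= 1.
        have w2 : 0 < 2 * w by rewrite mulr_gt0.
        move: xw; rewrite ler_norml => /andP[? ?].
        by rewrite /t divr_ge0 ?ler_pdivrMr ?mul1r//=; lra.
      have te : m - w + 2 * w * t = x by rewrite /t; field; rewrite gt_eqF.
      exists t; first by rewrite /= in_itv.
      have rn : 1 + rise x != 0 by rewrite gt_eqF// ltr_wpDr.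
      rewrite /bow clampE// /bow_pt te; congr (pr (x, - _)).
      by apply: (mulIf rn); rewrite mulVf.
    by rewrite neq_lt => /orP[]; [left|right].
  move=> h [t /=]; rewrite in_itv /= => t1 tz; move: h; rewrite -tz /bow clampE//.
  rewrite /setU /= FE; last exact: bow_strip.
  by rewrite height_bow// ltxx; case.
- by apply/seteqP; split => z // [/= h1 h2]; have := lt_trans h1 h2; rewrite ltxx.
- split.
  + exact: (open_comp (fun x _ => cF x) (@open_lt R 0)).
  + apply: (@path_in_connected R _ (m, - 1)) => z /= Fz.
    have [x [s [xz s1 x1]]] := lower_lift z.
    exists (x, - s) => //; move: Fz; rewrite -xz Flow// subr_lt0 => Fx.
    have [s0 s1'] := andP s1.
    have r0 : 0 < rise x.
      rewrite ltNge; apply/negP => rn.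
      have : s * rise x <= 0 by rewrite mulr_ge0_le0.
      by move: Fx; rewrite mulrDr mulr1; lra.
    have xw : `|x - m| < w by rewrite -rise_gt0.
    apply: (@path_in_trans _ _ _ (x, - 1)).
      apply: path_in_segment => t /andP[t0 t1].
      have -> : (1 - t) *: (m, -1) + t *: (x, -1) = ((1 - t) * m + t * x, - 1) :> R * R.
        by rewrite combE; congr (_, _); ring.
      split; first by apply: slower; rewrite unit_itv1.
      rewrite /= Flow ?unit_itv1// mul1r opprD addrA subrr sub0r oppr_lt0.
      have e : `|(1 - t) * m + t * x - m| < w.
        have -> : (1 - t) * m + t * x - m = t * (x - m) by ring.
        by rewrite normrM ger0_norm// (le_lt_trans _ xw)// ler_piMl.
      by rewrite rise_gt0// ltW// (lt_le_trans e).
    apply: path_in_segment => t /andP[t0 t1].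
    have -> : (1 - t) *: (x, -1) + t *: (x, - s) = (x, - ((1 - t) + t * s)) :> R * R.
      by rewrite combE; congr (_, _); ring.
    have ss : s <= 1 - t + t * s.
      rewrite -subr_ge0; have -> : 1 - t + t * s - s = (1 - t) * (1 - s) by ring.
      by rewrite mulr_ge0// subr_ge0.
    have s2 : 0 <= 1 - t + t * s <= 1.
      rewrite (le_trans s0 ss)/= -subr_ge0.
      have -> : 1 - (1 - t + t * s) = t * (1 - s) by ring.
      by rewrite mulr_ge0// subr_ge0.
    split; first exact: slower.
    rewrite /= Flow// subr_lt0 (lt_le_trans Fx)// ler_wpM2r//.
    by rewrite addr_ge0// ltW.
  + exists (pr (m, -1)); rewrite /= Flow ?unit_itv1// mul1r.
    by have := rise_mid; lra.
- split.
  + exact: (open_comp (fun x _ => cF x) (@open_gt R 0)).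
  + apply: (@path_in_connected R _ (0, 0)) => z /= Fz.
    have [x [s [xz s1 x1]]] := lower_lift z.
    exists (x, - s) => //; move: Fz; rewrite -xz Flow// subr_gt0 => Fx.
    have [s0 s1'] := andP s1.
    apply: (@path_in_trans _ _ _ (x, 0)).
      apply: path_in_segment => t _.
      have -> : (1 - t) *: (0, 0) + t *: (x, 0) = (t * x, 0) :> R * R.
        by rewrite combE; congr (_, _); ring.
      by rewrite -[0]oppr0; split; [apply: slower; rewrite unit_itv0|rewrite /= oppr0 F0].
    apply: path_in_segment => t /andP[t0 t1].
    have -> : (1 - t) *: (x, 0) + t *: (x, - s) = (x, - (t * s)) :> R * R.
      by rewrite combE; congr (_, _); ring.
    have s2 : 0 <= t * s <= 1 by rewrite mulr_ge0//= mulr_ile1.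
    split; first exact: slower.
    rewrite /= Flow// subr_gt0 -mulrA.
    move: Fx; move: (s * _) => A A1.
    have [A0|A0] := leP 0 A; first by rewrite (le_lt_trans _ A1)// ler_piMl.
    by rewrite (le_lt_trans (mulr_ge0_le0 t0 (ltW A0))).
  + by exists (pr (0, 0)); rewrite /= F0.
- split.
    apply: offcore_orientable => -[x y] sp /=.
    by apply: contraTneq => ->; rewrite F0 -leNgt.
  by apply: core_not_orientable => x; rewrite /= F0.
Qed.

End Bow.

(** * Classification of the c-arcs *)
Section Classification.
Variables (R : realType) (n : nat).
Hypothesis n0 : (0 < n)%N.
Implicit Types (a b c d k : int) (g h : R -> moebius R).

Local Notation vtx := (vtx R n).
Local Notation bot := (bot R n).
Local Notation top := (top R n).

(** With equal end points the arc is homotopic to a vertex, with consecutive ones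
    to an edge or a reversed edge. *)
Lemma short_arc_trivial g a b : joins g (bot a) (bot b) -> `|b - a| <= 1 ->
  trivial_arc n g.
Proof.
move=> j ab.
have [c c1] : exists c : int,
    (b = a \/ (c = a /\ b = c + 1)) \/ (c = b /\ a = c + 1).
  by exists (if b < a then b else a); case: ifP => ?; lia.
pose r : int := (c %% n)%Z; pose q : int := (c %/ n)%Z.
have [r0 rn] : 0 <= r /\ r < n by rewrite /r; lia.
have cE : c = `|r|%N%:Z + q * n by rewrite /r /q; lia.
have je : joins (edge n `|r|%N) (bot c) (bot (c + 1)).
  rewrite cE addrAC -!deck_even_bot//; apply: joins_deck; exact: edge_joins.
case: c1 => [[ba|[ca bc]]|[cb ac]].
- have [k kn kE] := pr_botE R n0 a; exists k => //; left.
  apply/(homotopicP _ j); left; rewrite ba.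
  exists (cst (bot a)); split => //; split => //; first exact: cst_continuous.
  by move=> t _; exact: strip_bot.
- exists `|r|%N; [lia|right].
  by apply/(homotopicP _ j); left; rewrite -ca bc.
- exists `|r|%N; [lia|right].
  by apply/(homotopicP _ j); right; rewrite -cb ac.
Qed.

Lemma bow_arc a b : a < b -> b <= a + n ->
  exists h, [/\ simple_arc n h, joins h (bot a) (bot b) & decomposes h].
Proof.
move=> ab ban.
pose m := (vtx a + vtx b) / 2; pose w := (vtx b - vtx a) / 2.
have w0 : 0 < w by rewrite divr_gt0// subr_gt0 ltr_vtx.
(* The arc has at most the width of a period of the boundary. *)
have w1 : w <= 1.
  have : vtx b <= vtx (a + 1 * n%:Z) by rewrite ler_vtx// mul1r.
  by rewrite (vtxD R n0 a 1) /w; lra.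
have jb : joins (bow m w) (bot a) (bot b).
  have -> : bot a = (m - w, -1) by rewrite /bot /m /w; congr (_, _); field.
  have -> : bot b = (m + w, -1) by rewrite /bot /m /w; congr (_, _); field.
  exact: bow_joins.
exists (bow m w); split => //; last exact: bow_decomposes.
have [cL sL Lg] := bow_lifts m w0 w1.
split.
- apply: continuous_subspaceT; apply: pr_comp_continuous; exact: bow_continuous.
- have [_ _ <- <-] := joins_pr jb; split; exact: vertices_bot.
- move=> t t01; have t1 : 0 <= t <= 1 by case/andP: t01 => ? ?; rewrite !ltW.
  rewrite /bow clampE// boundaryP; last exact: bow_strip.
  have := bow_rise_gt m w0 w1 t01; rewrite /bow_pt /=; move: (rise _ _ _) => r r0.
  have r1 : 1 < 1 + r by rewrite ltrDl.
  have : 0 < (1 + r)^-1 by rewrite invr_gt0 (lt_trans _ r1).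
  have : (1 + r)^-1 < 1 by rewrite invf_lt1// (lt_trans _ r1).
  by lra.
- by move=> s t s0 st t1; exact: bow_inj.
Qed.

Lemma long_arc_b_class g a b : simple_arc n g -> joins g (bot a) (bot b) ->
  1 < `|b - a| -> b_class (arc_class n g).
Proof.
move=> sg j ab; have [b1 b2] := simple_bot n0 sg j.
have [lt|lt] : a < b \/ b < a by lia.
  have [h [sh jh dh]] := bow_arc lt b1.
  by exists h => //; split => //; apply/(homotopicP _ j); left.
have [h [sh jh dh]] := bow_arc lt b2.
by exists h => //; split => //; apply/(homotopicP _ j); right.
Qed.

Lemma c_class_core_class (A : set (R -> moebius R)) : c_class n A ->
  exists a b, a <= b <= a + n /\ A = @core_class R n a b.
Proof.
case=> -[g [sg ntg ->]] nb.
have [a [b [j|j]]] := simple_arc_joins n0 sg.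
  exists a, b; split; first exact: simple_top sg j.
  exact: arc_class_core_class.
exfalso; have [ab|ab] := lerP `|b - a| 1.
  by apply: ntg; exact: short_arc_trivial j ab.
by apply: nb; exact: long_arc_b_class sg j ab.
Qed.

(** Shifting both indices by multiples of n brings a into [0, n). *)
Lemma c_class_finite : finite_set (@c_class R n).
Proof.
apply: (@sub_finite_set _ _ ((fun p : nat * nat => @core_class R n p.1 p.2) @`
    (`I_n `*` `I_(n + n)))).
  move=> A /c_class_core_class[a [b [ab ->]]].
  pose r : int := (a %% n)%Z; pose q : int := (a %/ n)%Z.
  have [r0 rn] : 0 <= r /\ r < n by rewrite /r; lia.
  have aE : a = r + q * n by rewrite /r /q; lia.
  pose s : int := b - q * n.
  have [s0 sn] : 0 <= s /\ s < n%:Z + n%:Z by rewrite /s; lia.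
  exists (`|r|%N, `|s|%N); first by split => /=; lia.
  rewrite /= -(core_class_shift R n0 _ _ q) !gez0_abs//.
  by congr (@core_class R n _ _); rewrite ?aE// /s; lia.
by apply: finite_image; apply: finite_setX; exact: finite_II.
Qed.

End Classification.

(** * Clique complexes and domination *)
Section Flag.
Variables (T : Type) (adj : T -> T -> Prop).
Hypothesis adjC : forall x y, adj x y -> adj y x.
Implicit Types (V S : set T).

(** The clique complex of the graph [adj] on the vertex set [V]. *)
Definition flag V : set (set T) :=
  [set S | [/\ finite_set S, S !=set0, S `<=` V &
    forall x y, S x -> S y -> x <> y -> adj x y]].

Lemma flag_sub V S S' : flag V S -> S' `<=` S -> S' !=set0 -> flag V S'.
Proof.
case=> fS _ SV aS S'S S'0; split => //; first exact: sub_finite_set fS.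
  exact: subset_trans SV.
by move=> x y /S'S xS /S'S yS; exact: aS.
Qed.

Lemma flag_simplicial V : simplicial_complex (flag V).
Proof.
move=> S fS; case: (fS) => fin S0 _ _; split => // S' S'S S'0.
exact: flag_sub fS S'S S'0.
Qed.

Lemma flag_vertex V v : V v -> flag V [set v].
Proof.
move=> Vv; split; [exact: finite_set1|by exists v|by move=> _ ->|].
by move=> x y -> ->.
Qed.

Lemma flag_add V S v : flag V S -> V v -> (forall x, S x -> x <> v -> adj v x) ->
  flag V (v |` S).
Proof.
case=> fS _ SV aS Vv vS; split.
- by rewrite finite_setU; split => //; exact: finite_set1.
- by exists v; left.
- by move=> x [->//|/SV].
- move=> x y [->|Sx] [->|Sy] xy //.
  + by apply: vS => // /esym.
  + by apply/adjC/vS.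
  + exact: aS.
Qed.

Lemma flag_deletion V v : vertex_deletion (flag V) v = flag (V `\ v).
Proof.
apply/seteqP; split => S.
  by case=> -[fS S0 SV aS] Sv; split => // x Sx; split; [exact: SV|move=> /= xv; apply: Sv; rewrite -xv].
case=> fS S0 SV aS; split; last by move=> /SV[_]; apply.
by split => // x /SV[].
Qed.

Lemma flag1 v : flag [set v] = [set [set v]].
Proof.
apply/seteqP; split => S /=; last by move=> ->; exact: flag_vertex.
case=> _ [x Sx] Sv _; apply/seteqP; split => // y ->.
by have <- : x = v := Sv x Sx.
Qed.

(** In a clique complex, domination of [v] by [v'] means that [v'] is adjacent to
    all neighbours of [v]; the subcomplex of the link of [v] formed by the
    simplices without [v'] is the other factor of the join. *)
Lemma flag_dominated V v v' : V v -> V v' -> v' <> v -> adj v v' ->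
  (forall x, V x -> x <> v -> x <> v' -> adj v x -> adj v' x) ->
  vertex_dominated (flag V) v v'.
Proof.
move=> Vv Vv' ne vv' dom; split => //; try exact: flag_vertex.
pose L := [set S | link (flag V) v S /\ ~ S v'].
have Ladj S x : link (flag V) v S -> S x -> x <> v -> adj v x.
  move=> [_ [_ [_ _ _ aS]]] Sx xv.
  by apply: aS; [left|right|move=> /esym].
exists L; split.
- move=> S [[fS [Sv fvS]] Sv']; case: (fS) => fin S0 _ _; split => // S' S'S S'0.
  split; last by move=> /S'S.
  split; first exact: flag_sub fS S'S S'0.
  split; first by move=> /S'S.
  by apply: flag_sub fvS _ _; [exact: setUS|exists v; left].
- by move=> S [[]].
- by case=> _; apply.
- apply/seteqP; split => S.
    move=> lS; have [Sv'|Sv'] := pselect (S v'); last by right; left.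
    have [[x [Sx xv']]|h] := pselect (exists x, S x /\ x <> v'); last first.
      left; apply/seteqP; split => [x Sx|x ->//].
      by apply: contrapT => xv'; apply: h; exists x.
    right; right; exists (S `\ v'); last by rewrite setD1K.
    case: lS => fS [Sv fvS]; split; last by case=> _; apply.
    split; first by apply: (flag_sub fS) => [y []|]//; exists x; split.
    split; first by case.
    by apply: (flag_sub fvS); [apply: setUS => y []|exists v; left].
  case=> [->|[[lS _]//|[S' [lS' S'v'] ->]]].
    split; first exact: flag_vertex.
    split; first by move=> /esym.
    apply: flag_add => //; first exact: flag_vertex.
    by move=> x ->.
  have [fS' [S'v fvS']] := lS'.
  have h1 : flag V (v' |` S').
    apply: flag_add => // x S'x xv'; case: (fS') => _ _ SV _.
    have xv : x <> v by move=> xv; apply: S'v; rewrite -xv.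
    by apply: dom => //; [exact: SV|exact: Ladj lS' S'x xv].
  split => //; split; first by case=> [/esym|].
  apply: flag_add => // x [->//|S'x] xv.
  exact: Ladj lS' S'x xv.
Qed.

End Flag.

(** * Collapsing level by level *)
Section Collapse.
Variables (R : realType) (n : nat).
Hypothesis n0 : (0 < n)%N.
Implicit Types (a b c d e k : int).

Local Notation core_class := (@core_class R n).
Local Notation adj := (@disjoint_classes R).

Lemma disjoint_classesC A B : adj A B -> adj B A.
Proof.
move=> [g [h [Ag Bh m]]]; exists h, g; split => // s t s1 t1 /esym e.
by have [] := m t s t1 s1 e.
Qed.

(** The level is invariant under (a, b) -> (b, a + n), which replaces b - a by
    n - (b - a). *)
Definition level a b : int := Num.min (b - a) (n%:Z - (b - a)).

Lemma level_orbit a b c d : same_orbit n a b c d -> level a b = level c d.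
Proof.
by case=> k [[-> ->]|[-> ->]]; rewrite /level ?mulrDl ?mul1r; lia.
Qed.

Lemma core_class_balanced_rep a b : a <= b <= a + n -> exists c d,
  [/\ core_class a b = core_class c d, c <= d <= c + n & d - c = level a b /\ 2 * (d - c) <= n%:Z].
Proof.
move=> ab; have [le|le] := lerP (2 * (b - a)) n%:Z.
  by exists a, b; rewrite /level; split => //; split => //; lia.
by exists b, (a + n); rewrite -core_class_flip//; split => //; [lia|rewrite /level; split; lia].
Qed.

(** A pair that is comparable with (a, b) but not with (a, b + 1) has second entry b
    and first entry greater than a, hence a level below b - a. *)
Lemma noncrossing_step a b c d : b - a <= level c d ->
  noncrossing n a b c d -> noncrossing n a (b + 1) c d.
Proof.
rewrite /level => ab co k; have [] := co k.
rewrite /unlinked mulrDl mul1r => h1 h2; split; lia.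
Qed.

Lemma noncrossing_next a b : a <= b <= a + n -> b - a + 1 <= n%:Z -> noncrossing n a b a (b + 1).
Proof.
move=> ab abn k; rewrite /unlinked mulrDl mul1r.
by case: (mulz_cases n0 k) => -[? ?]; split; lia.
Qed.

(** All differences of second and first entries are l or l + 1 here, and pairs
    of integers whose differences vary by at most one are comparable. *)
Lemma noncrossing_balanced l a b c d : l <= level a b -> l <= level c d ->
  n%:Z <= 2 * l + 1 -> noncrossing n a b c d.
Proof.
rewrite /level => ab cd nl k; rewrite /unlinked mulrDl mul1r; split; lia.
Qed.

(** The vertex sets that occur when classes are removed by increasing level. *)
Definition up_closed (V : set (set (R -> moebius R))) :=
  V `<=` @c_class R n /\ forall a b c d, a <= b <= a + n -> c <= d <= c + n ->
    V (core_class a b) -> level a b < level c d -> V (core_class c d).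

Lemma min_level V : up_closed V -> V !=set0 -> exists a b,
  [/\ V (core_class a b), a <= b <= a + n, b - a = level a b, 2 * (b - a) <= n%:Z &
    forall c d, c <= d <= c + n -> V (core_class c d) -> level a b <= level c d].
Proof.
move=> [Vc _] [A VA].
pose P (k : nat) := `[< exists a b, [/\ a <= b <= a + n, V (core_class a b) & level a b = k] >].
have [a [b [ab AE]]] := c_class_core_class n0 (Vc _ VA).
have exP : exists k : nat, P k.
  exists `|level a b|%N; apply/asboolP; exists a, b; split => //; first by rewrite -AE.
  by rewrite /level; lia.
case: (ex_minnP exP) => k /asboolP[c [d [cd Vcd levcd]]] kmin.
have [c' [d' [E cd' [l1 l2]]]] := core_class_balanced_rep cd.
have lE : level c' d' = level c d by rewrite -{}l1 /level; lia.
exists c', d'; rewrite -E lE; split => // e f ef Vef.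
rewrite levcd; have := kmin `|level e f|%N.
have lp : 0 <= level e f by rewrite /level; lia.
have h : P `|level e f|%N.
  by apply/asboolP; exists e, f; split => //; lia.
by move=> /(_ h); lia.
Qed.

Lemma up_closed_delete V a b : up_closed V ->
  (forall c d, c <= d <= c + n -> V (core_class c d) -> level a b <= level c d) ->
  up_closed (V `\ core_class a b).
Proof.
move=> [Vc Vu] low; split; first by move=> A [/Vc].
move=> c d e f cd ef [Vcd _] lt; split; first exact: Vu Vcd lt.
move=> /= E; have lE := level_orbit (core_class_eq_orbit n0 ef E).
by have := low _ _ cd Vcd; rewrite -lE; lia.
Qed.

Lemma dominating V a b : up_closed V -> V (core_class a b) -> a <= b <= a + n ->
  b - a = level a b -> 2 * (b - a) <= n%:Z ->
  (forall c d, c <= d <= c + n -> V (core_class c d) -> level a b <= level c d) ->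
  V = [set core_class a b] \/ exists v', vertex_dominated (flag adj V) (core_class a b) v'.
Proof.
move=> [Vc Vu] Vab ab levab le low.
have rep A : V A -> exists c d, [/\ c <= d <= c + n, A = core_class c d & level a b <= level c d].
  move=> VA; have [c [d [cd E]]] := c_class_core_class n0 (Vc _ VA).
  by exists c, d; split => //; apply: low => //; rewrite -E.
have dis c d e f : c <= d <= c + n -> e <= f <= e + n -> noncrossing n c d e f ->
    core_class e f <> core_class c d -> adj (core_class c d) (core_class e f).
  move=> cd ef co ne; apply: noncrossing_disjoint => // so; apply: ne.
  by rewrite (core_class_orbit R n0 so).
have [lt|ge] := ltrP (2 * (b - a) + 1) n%:Z.
  (* There is a class of higher level to the right of (a, b). *)
  right; exists (core_class a (b + 1)).
  have ab1 : a <= b + 1 <= a + n by lia.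
  have lev1 : level a b < level a (b + 1) by rewrite -levab /level; lia.
  have ne : core_class a (b + 1) <> core_class a b.
    by move=> E; have := level_orbit (core_class_eq_orbit n0 ab1 E); lia.
  apply: flag_dominated => //; first exact: disjoint_classesC.
  - exact: Vu Vab lev1.
  - by apply: dis => //; apply: noncrossing_next => //; lia.
  - move=> A VA Av Av' adjA; have [c [d [cd E l]]] := rep A VA.
    rewrite E in Av' adjA *; apply: dis => //.
    by apply: noncrossing_step; [lia|exact: (disjoint_noncrossing n0 adjA)].
(* All the remaining classes are pairwise adjacent. *)
have [[A [VA ne]]|h] := pselect (exists A, V A /\ A <> core_class a b); last first.
  left; apply/seteqP; split => [A VA|A ->//].
  by apply: contrapT => ne; apply: h; exists A.
right; exists A; have [c [d [cd E l]]] := rep A VA.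
apply: flag_dominated => //; first exact: disjoint_classesC.
- rewrite E in ne *; apply: dis => //.
  by apply: (@noncrossing_balanced (b - a)) => //; rewrite levab.
- move=> B VB Bv BA _; have [e [f [ef EB lB]]] := rep B VB.
  rewrite EB E in BA *; apply: dis => //.
  by apply: (@noncrossing_balanced (b - a)) => //; rewrite levab.
Qed.

(** Induction on the number of classes: a class of least level is dominated
    unless it is the only one left, and deleting it preserves [up_closed]. *)
Lemma flag_collapses (X : {fset (set (R -> moebius R))}) : up_closed [set` X] -> [set` X] !=set0 ->
  collapses_to_vertex (flag adj [set` X]).
Proof.
elim: {X}#|` X| {-2}X (erefl #|` X|) => [|N IH] X.
  by move=> /cardfs0_eq -> _ [].
move=> XN up ne; have [a [b [Vab ab levab le low]]] := min_level up ne.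
have [->|[v' dom]] := dominating up Vab ab levab le low.
  exact: (@collapse_nil _ _ (core_class a b)) (flag1 _ _).
apply: (collapse_cons dom); rewrite flag_deletion.
have XE : [set` X] `\ core_class a b = [set` (X `\ core_class a b)%fset].
  by rewrite set_fsetD1.
rewrite XE; apply: IH.
- by move: XN; rewrite (cardfsD1 (core_class a b)) Vab => -[].
- by rewrite -XE; exact: up_closed_delete.
- rewrite -XE; exists v'; case: dom => _ [_ _ v'V _] v'v _; split => //.
  by apply: v'V.
Qed.

End Collapse.

Theorem theorem2 (R : realType) (n : nat) (hn : (1 <= n)%N) :
  strongly_collapsible (inner_arc_complex R n).
Proof.
have [X XE] : exists X : {fset (set (R -> moebius R))}, @c_class R n = [set` X].
  by have /finite_fsetP := c_class_finite R hn.
have -> : inner_arc_complex R n = flag (@disjoint_classes R) (@c_class R n) by [].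
split; first exact: flag_simplicial.
  rewrite XE; apply: (@sub_finite_set _ _ ((fun f => [set` f]) @` [set` fpowerset X])).
    move=> S [/finite_fsetP[f ->] _ fX _]; exists f => //=.
    by rewrite fpowersetE; apply/fsubsetP => x xf; exact: fX.
  by apply: finite_image; exact: finite_fset.
rewrite XE; apply: (flag_collapses hn).
  rewrite -XE; split => // a b c d _ cd _ _; exact: core_class_c_class.
by rewrite -XE; exists (@core_class R n 0 0); apply: core_class_c_class => //; lia.
Qed.
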